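(* Let $\gamma_n=c_\gamma n^{-\alpha}$ with $c_\gamma>0$ and $\alpha\in(1/2,1)$. Suppose the following hypotheses hold. (i) For every $h\in H$, $g(x,\cdot)$ is Fréchet-differentiable at $h$ for $P_X$-almost every $x\in\mathcal X$; $G$ is differentiable; and $m\in H$ satisfies $\nabla G(m)=0$. (ii) $G$ is twice continuously differentiable, and for every $A>0$ there is $C_A>0$ such that $\|\Gamma_h\|_{op}\le C_A$ for all $h\in\mathcal B(m,A)$. (iii) At least one of the following holds: (iii.a) there is $\epsilon>0$ such that for every $h\in\mathcal B(m,\epsilon)$ there is an orthonormal basis of $H$ composed of eigenvectors of $\Gamma_h$; the infimum $\lambda_{\min}$ of the eigenvalues of $\Gamma_m$ is positive; and for every $h\in\mathcal B(m,\epsilon)$, every eigenvalue $\lambda_h$ of $\Gamma_h$ satisfies $\lambda_h\ge\lambda_{\min}/2>0$; (iii.b) there is an orthonormal basis of $H$ composed of eigenvectors of $\Gamma_m$, the infimum $\lambda_{\min}$ of the eigenvalues of $\Gamma_m$ is positive, and there are constants $c,c'>0$ such that for all $A>0$ and all $h\in\mathcal B(m,A)$, $\langle\nabla G(h),h-m\rangle\ge\min\{c,c'/A\}\,\|h-m\|^2$. (iv) There are $\epsilon',C_{\epsilon'}>0$ such that $\|\nabla G(h)-\Gamma_m(h-m)\|\le C_{\epsilon'}\|h-m\|^2$ for all $h\in\mathcal B(m,\epsilon')$. (v) At least one of the following holds: (v.a) there are a measurable function $f:\mathcal X\times H\to\mathbb R_+$ and a constant $C>0$ such that for $P_X$-almost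 every $x\in\mathcal X$ and all $h\in H$, $\|\nabla_h g(x,h)\|\le f(x,h)+C\|h-m\|$, and for every integer $q\ge1$ there is $L_q>0$ such that $\mathbb E[f(X,h)^{2q}]\le L_q$ for all $h\in H$; (v.b) for every integer $q\ge1$ there is $L_q>0$ such that $\mathbb E[\|\nabla_h g(X,h)\|^{2q}]\le L_q(1+\|h-m\|^{2q})$ for all $h\in H$. Then, for every integer $p\ge1$, there is a positive constant $K_p$ such that for all $n\ge1$, $$\mathbb E\left[\|Z_n-m\|^{2p}\right]\le\frac{K_p}{n^{p\alpha}}.$$
   Context: $H$ is a separable real Hilbert space with inner product $\langle\cdot,\cdot\rangle$ and norm $\|\cdot\|$; $\|\cdot\|_{op}$ is the operator (spectral) norm; $\mathcal B(m,r)=\{h\in H:\|h-m\|\le r\}$. $X$ is a random variable with law $P_X$ taking values in a measurable space $\mathcal X$, $g:\mathcal X\times H\to\mathbb R$, and $G(h):=\mathbb E[g(X,h)]$ is a well-defined real-valued function on $H$ which is assumed to be convex. $\nabla_h g(x,h)\in H$ denotes the gradient of $g(x,\cdot)$ at $h$ (viewed as a measurable function of $(x,h)$), and $\nabla G(h)=\mathbb E[\nabla_h g(X,h)]$ for all $h\in H$. $\Gamma_h$ denotes the Hessian of $G$ at $h$ (a bounded self-adjoint operator on $H$). Algorithm: $X_1,X_2,\dots$ are independent random variables with the same law as $X$; $\mathcal F_n=\sigma(X_1,\dots,X_n)$; $Z_1$ is an $\mathcal F_1$-measurable bounded $H$-valued random variable; for $n\ge1$, $Z_{n+1}=Z_n-\gamma_n\nabla_h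 g(X_{n+1},Z_n)$. *)

(* Defs.v *)
From mathcomp Require Export all_boot all_order all_algebra finmap.
From mathcomp Require Export sesquilinear.
From mathcomp Require Export all_classical all_reals all_analysis.

Set Implicit Arguments.
Unset Strict Implicit.
Unset Printing Implicit Defensive.

Export Order.TTheory GRing.Theory Num.Theory.
Export numFieldNormedType.Exports.

Local Open Scope classical_set_scope.
Local Open Scope ring_scope.

(* A real Hilbert space is a complete normed module H whose norm is induced by
   a positive definite symmetric bilinear form. *)
Definition norm_from_dot (R : realType) (H : completeNormedModType R)
    (dot : {dot H for idfun}) : Prop :=
  forall u : H, `|u| = Num.sqrt (dot u u).

Definition separable_space (T : topologicalType) : Prop :=
  exists2 D : set T, countable D & dense D.

Notation borel H := (g_sigma_algebraType (@open H)).

(* F : H -> R has gradient v at h; R^o is R seen as a normed space over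
   itself. *)
Definition is_gradient (R : realType) (H : completeNormedModType R)
    (dot : {dot H for idfun}) (F : H -> R) (h v : H) : Prop :=
  is_diff h (F : H -> R^o) (dot v : H -> R^o).

Definition selfadjoint (R : realType) (H : completeNormedModType R)
    (dot : {dot H for idfun}) (A : H -> H) : Prop :=
  forall u v : H, dot (A u) v = dot u (A v).

(* The Hessian at h of a function with gradient field gradF; linearity and
   boundedness of A are part of is_diff. *)
Definition is_hessian (R : realType) (H : completeNormedModType R)
    (dot : {dot H for idfun}) (gradF : H -> H) (h : H) (A : H -> H) : Prop :=
  is_diff h gradF A /\ selfadjoint dot A.

(* Extended-real valued, so that it is +oo for an unbounded operator. *)
Definition op_norm (R : realType) (H : completeNormedModType R)
    (A : H -> H) : \bar R :=
  ereal_sup [set `|A u|%:E | u in [set u : H | `|u| <= 1]].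

Definition is_eigenvector (R : realType) (H : completeNormedModType R)
    (A : H -> H) (l : R) (u : H) : Prop :=
  u != 0 /\ A u = l *: u.

Definition is_eigenvalue (R : realType) (H : completeNormedModType R)
    (A : H -> H) (l : R) : Prop :=
  exists u : H, is_eigenvector A l u.

(* Extended-real valued, so that it is a genuine infimum in all cases. *)
Definition inf_eigenvalues (R : realType) (H : completeNormedModType R)
    (A : H -> H) : \bar R :=
  ereal_inf [set l%:E | l in [set l : R | is_eigenvalue A l]].

Definition linear_span (R : realType) (H : completeNormedModType R)
    (B : set H) : set H :=
  [set v | exists (n : nat) (a : 'I_n -> R) (b : 'I_n -> H),
     (forall i, B (b i)) /\ v = \sum_(i < n) a i *: b i].

(* Hilbert basis: an orthonormal set with dense linear span. *)
Definition orthonormal_basis (R : realType) (H : completeNormedModType R)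
    (dot : {dot H for idfun}) (B : set H) : Prop :=
  (forall u v : H, B u -> B v -> dot u v = (u == v)%:R) /\
  dense (linear_span B).

Definition has_eigenbasis (R : realType) (H : completeNormedModType R)
    (dot : {dot H for idfun}) (A : H -> H) : Prop :=
  exists B : set H, orthonormal_basis dot B /\
    forall u : H, B u -> exists l : R, is_eigenvector A l u.

(* v is the (Bochner) expectation of the H-valued random variable Y: in a
   separable Hilbert space this is the vector determined by
   <v, u> = E[<Y, u>] for all u, with E[||Y||] finite. *)
Definition is_expectation d (T : measurableType d) (R : realType)
    (H : completeNormedModType R) (dot : {dot H for idfun})
    (P : probability T R) (Y : T -> H) (v : H) : Prop :=
  [/\ measurable_fun [set: T] (Y : T -> borel H),
      P.-integrable [set: T] (fun w => `|Y w|%:E)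
    & forall u : H, ('E_P[fun w => dot (Y w) u] = (dot v u)%:E)%E].

Definition independent_family d d' (T : measurableType d)
    (T' : measurableType d') (R : realType) (P : probability T R)
    (I : set nat) (X : nat -> T -> T') : Prop :=
  forall (J : {fset nat}) (A : nat -> set T'),
    [set` J] `<=` I -> (forall i, measurable (A i)) ->
    P (\bigcap_(i in [set` J]) (X i @^-1` A i)) =
    (\prod_(i <- J) P (X i @^-1` A i))%E.

Definition same_law d d' (T : measurableType d) (T' : measurableType d')
    (R : realType) (P : probability T R) (X Y : {RV P >-> T'}) : Prop :=
  forall A : set T', measurable A -> distribution P X A = distribution P Y A.

(* sigma(X_1, ..., X_n); the index 0 is not used. *)
Definition natural_filtration d d' (T : measurableType d)
    (T' : measurableType d') (X : nat -> T -> T') (n : nat) : set (set T) :=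
  <<s \bigcup_(i in [set i | (1 <= i <= n)%N])
        preimage_set_system [set: T] (X i) measurable >>.

Definition sigma_measurable (T : Type) (F : set (set T))
    d (U : measurableType d) (Y : T -> U) : Prop :=
  forall B : set U, measurable B -> F (Y @^-1` B).

(* Main.v *)
(** Write [r = |h - m|] and [u p n = E |Z n - m| ^ (2 p)]. Convexity of [G], the
coercivity of its Hessian at [m] and the Taylor bound near [m] give the drift
[<grad G h, h - m> >= c min(r, r ^ 2)]. Expanding [|Z n.+1 - m| ^ (2 p + 2)] and
integrating out the fresh observation, which is independent of [Z n], yields for
every [0 <= B <= 1]
  [u (p+1) (n+1) <= (1 + C gamma^2 - kappa gamma B) u (p+1) n
     + kappa gamma B^(2q+1) u (p+1+q) n + C gamma^2 u p n + C gamma^(2p+2)],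
because [min(r, r ^ 2) >= B r ^ 2 - B ^ (2q+1) r ^ (2q+2)]. With [B = 0] all
moments are bounded. With [B = n ^ (- s)], [s] small, and [q] large, induction on
[p] gives [u p n = O(n ^ (- p (alpha - s)))]. Then, [u (p+q) n] being negligible
for [q] large, [B = 1] gives the rate [n ^ (- p alpha)]. *)

(* The drift grows only linearly at infinity, so the moment of order [2 p + 2] is contracted only
   through the power [2 p + 1] of [r], which is no fixed multiple of that moment. The parameter [B]
   repairs this: it yields a contraction of strength [gamma B], at the price of a higher moment
   damped by [B ^ (2 q + 1)]. An induction on [p] alone would thus be circular, and the uniform
   bounds on all moments break the circle. They come from the summability of [gamma ^ 2], that is
   from [alpha > 1 / 2]. For [B = n ^ (- s)] the contraction [n ^ (- alpha - s)] must beat [1 / n],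
   the relative decrease of the target rate; hence [s < 1 - alpha], which leaves room because
   [alpha < 1]. The first pass loses a factor [n ^ s] per order, but it holds at all orders; the
   second pass reads it at an order so high that the loss is made up. *)
From HB Require Import structures.
Require Import Defs.
From mathcomp Require Import measurable_realfun.
From mathcomp Require Import ring lra.

Set Implicit Arguments.
Unset Strict Implicit.
Unset Printing Implicit Defensive.

Local Open Scope classical_set_scope.
Local Open Scope ring_scope.

(** * Rates for real recursions *)

Section real_sequences.
Context {R : realType}.
Implicit Types (a b c d x y : R) (u : nat -> R).

Lemma powR_small d e : 0 < d -> 0 < e ->
  exists N : nat, forall n : nat, (N <= n)%N -> n%:R `^ (- d) <= e.
Proof.
move=> d0 e0; exists (Num.truncn (e^-1 `^ d^-1)).+1 => n Nn.
have e10 : 0 <= e^-1 by rewrite invr_ge0 ltW.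
have h : e^-1 `^ d^-1 <= n%:R.
  by apply: ltW; apply: (lt_le_trans (truncnS_gt _)); rewrite ler_nat.
have : e^-1 <= n%:R `^ d.
  rewrite -[leLHS](powRr1 e10) -[X in _ `^ X <= _](mulVf (lt0r_neq0 d0)) powRrM.
  by apply: (ge0_ler_powR (ltW d0) _ _ h); rewrite nnegrE ?powR_ge0 ?ler0n.
rewrite powRN => h1; rewrite -[leRHS]invrK lef_pV2 ?posrE ?invr_gt0//.
by rewrite (lt_le_trans _ h1)// invr_gt0.
Qed.

(** After factoring out [n ^ (- b)], this is [exp x >= 1 + x] followed by [ln (1 + x) <= x], at
    [x = 1 / n]. *)
Lemma powR_succ_ge b (n : nat) : 0 <= b -> (0 < n)%N ->
  n%:R `^ (- b) * (1 - b / n%:R) <= n.+1%:R `^ (- b).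
Proof.
move=> b0 n0; have nR : (0 : R) < n%:R by rewrite ltr0n.
have n1 : n.+1%:R = n%:R * (1 + n%:R^-1) :> R.
  by rewrite mulrDr mulr1 divff ?lt0r_neq0// -natr1.
have i0 : (0 : R) < n%:R^-1 by rewrite invr_gt0.
rewrite n1 powRM ?(ltW nR) ?addr_ge0 ?(ltW i0)//.
apply: ler_wpM2l; first exact: powR_ge0.
rewrite /powR gt_eqF ?addr_gt0//.
apply: le_trans (expR_ge1Dx _); rewrite mulNr lerD2l lerN2.
by apply: ler_wpM2l => //; apply: le_ln1Dx; rewrite (lt_trans _ i0)// ltrN10.
Qed.

(** With [y = 1 / n <= 1], one factor 2 is lost in [ln (1 + y) >= y / 2] and another in
    [1 / (1 + z) <= 1 - z / 2] for [z = d * y / 2]; hence the 4. *)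
Lemma powR_succ_le d (n : nat) : 0 < d <= 1 -> (0 < n)%N ->
  n.+1%:R `^ (- d) <= n%:R `^ (- d) * (1 - d / 4 / n%:R).
Proof.
move=> /andP[d0 d1] n0; have nR : (0 : R) < n%:R by rewrite ltr0n.
have n1 : n.+1%:R = n%:R * (1 + n%:R^-1) :> R.
  by rewrite mulrDr mulr1 divff ?lt0r_neq0// -natr1.
have i0 : (0 : R) < n%:R^-1 by rewrite invr_gt0.
have i1 : n%:R^-1 <= 1 :> R by rewrite invf_le1 ?ler1n.
rewrite n1 powRM ?(ltW nR) ?addr_ge0 ?(ltW i0)//.
apply: ler_wpM2l; first exact: powR_ge0.
rewrite powRN; set y := n%:R^-1 in i0 i1 *.
have y1 : 0 < 1 + y by rewrite addr_gt0.
have hl : y / 2 <= ln (1 + y).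
  have : ln (1 + (- (y / (1 + y)))) <= - (y / (1 + y)).
    by apply: le_ln1Dx; rewrite ltrN2 ltr_pdivrMr// mul1r ltrDr.
  have -> : 1 + (- (y / (1 + y))) = (1 + y)^-1 by field; rewrite lt0r_neq0.
  rewrite lnV ?posrE// lerN2; apply: le_trans.
  by rewrite ler_pM2l// lef_pV2 ?posrE//; lra.
have hp : 1 + d * (y / 2) <= (1 + y) `^ d.
  rewrite /powR gt_eqF//; apply: le_trans (expR_ge1Dx _).
  by rewrite lerD2l ler_pM2l.
have dy : 0 < d * y by rewrite mulr_gt0.
apply: (@le_trans _ _ (1 + d * (y / 2))^-1).
  by rewrite lef_pV2 ?posrE ?powR_gt0//; lra.
rewrite -[leLHS]mul1r ler_pdivrMr; last by lra.
have : d * y <= 1 by rewrite mulr_ile1// ltW.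
move=> dy1; rewrite -subr_ge0.
have -> : (1 - d / 4 * y) * (1 + d * (y / 2)) - 1 = d * y * (2 - d * y) / 8 by field.
by rewrite divr_ge0// mulr_ge0 ?(ltW dy)//; lra.
Qed.

(* Beyond the threshold [N], [K * n `^ (- b)] is a supersolution of the
   recursion: one step decreases it by a relative amount of order [1 / n], which
   is negligible against the contraction [c * n `^ (- a)] since [a < 1]. *)
Lemma contraction_rate u a b c C (n0 : nat) : 0 < a < 1 -> 0 <= b -> 0 < c -> 0 <= C ->
  (forall n, 0 <= u n) ->
  (forall n, (n0 <= n)%N -> u n.+1 <=
     (1 - c * n%:R `^ (- a)) * u n + C * n%:R `^ (- (a + b))) ->
  exists2 K, 0 < K & forall n, (1 <= n)%N -> u n <= K * n%:R `^ (- b).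
Proof.
move=> /andP[a0 a1] b0 c0 C0 u0 rec.
(* Past [N1] the factor [1 - c * n ^ (- a)] is nonnegative, so the induction hypothesis may be
   multiplied by it; past [N2] the loss [b / n] is at most half of the contraction. The denominator
   [b + 1] covers [b = 0]. *)
have [N1 hN1] : exists N : nat, forall n : nat, (N <= n)%N ->
    n%:R `^ (- a) <= c^-1 by apply: powR_small => //; rewrite invr_gt0.
have [N2 hN2] : exists N : nat, forall n : nat, (N <= n)%N ->
    n%:R `^ (- (1 - a)) <= c / 2 / (b + 1).
  by apply: powR_small; rewrite ?subr_gt0// !divr_gt0//; lra.
pose N := (n0 + N1 + N2).+1.
(* The sum makes the bound true up to [N]; with [2 * C / c], the remaining half of the contraction
   pays for the forcing term. *)
pose K := 2 * C / c + 1 + \sum_(i < N.+1) u i * i%:R `^ b.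
have S0 : 0 <= \sum_(i < N.+1) u i * i%:R `^ b.
  by apply: sumr_ge0 => i _; rewrite mulr_ge0// powR_ge0.
have Cc : 0 <= 2 * C / c by rewrite divr_ge0 ?(ltW c0)// mulr_ge0.
have K0 : 0 < K by rewrite /K; lra.
exists K => // n n1.
have small k : (1 <= k)%N -> (k <= N)%N -> u k <= K * k%:R `^ (- b).
  move=> k1 kN; rewrite powRN ler_pdivlMr ?powR_gt0 ?ltr0n//.
  rewrite /K (bigD1 (Ordinal (kN : (k < N.+1)%N)))//= addrCA lerDl.
  rewrite addr_ge0//; first by lra.
  by apply: sumr_ge0 => i _; rewrite mulr_ge0// powR_ge0.
have [nN|nN] := leqP n N; first exact: small.
rewrite -(subnKC (ltnW nN)); elim: (n - N)%N => [|k IH].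
  by rewrite addn0; apply: small.
rewrite addnS; set l := (N + k)%N in IH *.
have l0 : (0 < l)%N by rewrite /l /N addSn.
have lR : (0 : R) < l%:R by rewrite ltr0n.
have lr0 : l%:R != 0 :> R by rewrite gt_eqF.
have Nl : (N <= l)%N by apply: leq_addr.
have ln0 : (n0 <= l)%N.
  by apply: leq_trans Nl; rewrite /N -addnA; apply: leqW; apply: leq_addr.
have l1 : (N1 <= l)%N.
  by apply: leq_trans Nl; rewrite /N -addnA addnCA; apply: leqW; apply: leq_addr.
have l2 : (N2 <= l)%N by apply: leq_trans Nl; rewrite /N; apply: leqW; apply: leq_addl.
apply: (le_trans (rec _ ln0)).
have h1 : 0 <= 1 - c * l%:R `^ (- a).
  by rewrite subr_ge0 mulrC -ler_pdivlMr// div1r; apply: hN1.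
have B0 : 0 < l%:R `^ (- b) by rewrite powR_gt0.
have A0 : 0 < l%:R `^ (- a) by rewrite powR_gt0.
apply: (@le_trans _ _ (K * (l%:R `^ (- b) * (1 - b / l%:R)))); last first.
  by apply: ler_wpM2l; rewrite ?(ltW K0)//; apply: powR_succ_ge.
apply: (@le_trans _ _ ((1 - c * l%:R `^ (- a)) * (K * l%:R `^ (- b)) +
   C * l%:R `^ (- (a + b)))).
  by rewrite lerD2r; apply: ler_wpM2l.
have -> : l%:R `^ (- (a + b)) = l%:R `^ (- a) * l%:R `^ (- b).
  by rewrite opprD powRD// lr0 implybT.
have inv : l%:R^-1 = l%:R `^ (- a) * l%:R `^ (- (1 - a)).
  rewrite -powRD ?lr0 ?implybT// -powR_inv1 ?(ltW lR)//; congr powR; ring.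
rewrite inv; have := hN2 _ l2.
move: (l%:R `^ (- (1 - a))) (powR_ge0 (l%:R : R) (- (1 - a))) => X X0 hX.
set A := l%:R `^ (- a) in h1 A0 *; set B := l%:R `^ (- b) in B0 *.
have hb : b * X <= c / 2.
  move: hX; rewrite ler_pdivlMr; last by lra.
  by move=> hX; apply: le_trans hX; rewrite mulrDr mulr1 mulrC lerDl.
have hK : C <= K * (c / 2).
  have : 2 * C / c <= K by rewrite /K; lra.
  by rewrite ler_pdivrMr//; lra.
have : 0 <= (K * (c - b * X) - C) * (A * B).
  apply: mulr_ge0; last by rewrite mulr_ge0 ?ltW.
  have : K * (c / 2) <= K * (c - b * X) by rewrite ler_pM2l//; lra.
  by lra.
by lra.
Qed.

(** A discrete Gronwall bound with the summable weights [n ^ (- a)]. An explicit bounded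
    supersolution replaces the infinite product. *)
Lemma summable_growth_bounded u a C : 1 < a -> 0 <= C ->
  (forall n, 0 <= u n) ->
  (forall n, (1 <= n)%N ->
     u n.+1 <= (1 + C * n%:R `^ (- a)) * u n + C * n%:R `^ (- a)) ->
  exists2 K, 0 < K & forall n, (1 <= n)%N -> u n <= K.
Proof.
move=> a1 C0 u0 rec.
(* Since [1 + 2 * d <= a], one factor [n ^ (- d)] of [n ^ (- a)] absorbs the constants, while the
   other, times [1 / n], matches the growth of the supersolution. *)
pose d := Num.min 1 ((a - 1) / 2).
have d01 : 0 < d <= 1 by rewrite /d lt_min ge_min lexx ltr01 andbT/=; lra.
have da : d + d <= a - 1.
  have : d <= (a - 1) / 2 by rewrite /d ge_min lexx orbT.
  by lra.
have [d0 d1] := andP d01.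
have [N' hN'] : exists N : nat, forall n : nat, (N <= n)%N ->
    n%:R `^ (- d) <= d / 4 / (4 * C + 1).
  by apply: powR_small; rewrite // !divr_gt0//; lra.
pose N := N'.+1.
pose K := 1 + \sum_(i < N.+1) u i.
have S0 : 0 <= \sum_(i < N.+1) u i by apply: sumr_ge0.
have small k : (k <= N)%N -> 1 + u k <= K.
  move=> kN; rewrite /K (bigD1 (Ordinal (kN : (k < N.+1)%N)))//= lerD2l lerDl.
  by apply: sumr_ge0.
have p01 l : (1 <= l)%N -> 0 < l%:R `^ (- d) <= 1.
  move=> l1; rewrite powR_gt0 ?ltr0n//= -[leRHS](powRr0 l%:R).
  by apply: ler_powR; rewrite ?ler1n//; lra.
(* The supersolution [K * (2 - n `^ (- d))] grows by at least a multiple of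
   [n `^ (- 1 - d)], which dominates [n `^ (- a)]. *)
have main k : 1 + u (N + k)%N <= K * (2 - (N + k)%:R `^ (- d)).
  elim: k => [|k IH].
    rewrite addn0; apply: (le_trans (small _ (leqnn _))).
    by rewrite ler_peMr; [done|rewrite /K; lra|have := p01 N isT; lra].
  rewrite addnS; set l := (N + k)%N in IH *.
  have l1 : (1 <= l)%N by rewrite /l /N addSn.
  have Nl : (N' <= l)%N by rewrite /l /N addSn; apply: leqW; apply: leq_addr.
  have lR : (0 : R) < l%:R by rewrite ltr0n.
  have lr0 : l%:R != 0 :> R by rewrite gt_eqF.
  have := powR_succ_le d01 l1; have := p01 _ l1; have := hN' _ Nl.
  have := rec _ l1.
  have -> : d / 4 / l%:R = d / 4 * l%:R `^ (-1) by rewrite powR_inv1 ?(ltW lR).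
  have hE : l%:R `^ (- a) <= l%:R `^ (- d) * (l%:R `^ (- d) * l%:R `^ (-1)).
    rewrite -!powRD ?lr0 ?implybT//; apply: ler_powR; rewrite ?ler1n//; lra.
  move: hE.
  have E0 := powR_ge0 (l%:R : R) (- a); have J0 := powR_ge0 (l%:R : R) (-1).
  set E := l%:R `^ (- a) in E0 *; set J := l%:R `^ (-1) in J0 *.
  set D := l%:R `^ (- d) in IH *; set D' := _ `^ (- d).
  move=> hE hrec hD /andP[D0 D1] hD'.
  have K1 : 1 <= K by rewrite /K; lra.
  have CE0 : 0 <= C * E by rewrite mulr_ge0.
  have hCE : 4 * C * E <= D * (d / 4 * J).
    have C41 : 0 < 4 * C + 1 by lra.
    have hD2 : (4 * C + 1) * D <= d / 4 by move: hD; rewrite ler_pdivlMr// mulrC.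
    have DJ0 : 0 <= D * J by rewrite mulr_ge0 ?(ltW D0).
    have h1 : 4 * C * E <= 4 * C * (D * (D * J)) by apply: ler_wpM2l => //; lra.
    have h2 : (4 * C + 1) * D * (D * J) <= d / 4 * (D * J) by apply: ler_wpM2r.
    have h3 : 0 <= D * (D * J) by rewrite mulr_ge0 ?(ltW D0).
    by lra.
  (* Passing to [1 + u] merges the additive term into the growth factor. *)
  have step : 1 + u l.+1 <= (1 + 2 * (C * E)) * (1 + u l).
    by have := mulr_ge0 CE0 (u0 l); lra.
  apply: (le_trans step).
  apply: (@le_trans _ _ ((1 + 2 * (C * E)) * (K * (2 - D)))).
    by apply: ler_wpM2l => //; lra.
  rewrite mulrCA ler_pM2l; last by lra.
  by have := mulr_ge0 CE0 (ltW D0); lra.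
exists (K * 2); first by rewrite /K; lra.
move=> n n1; have [nN|nN] := leqP n N.
  by have := small _ nN; rewrite /K; lra.
have := main (n - N)%N; rewrite subnKC ?(ltnW nN)// => h.
have := p01 _ n1 => /andP[p0 _].
have : 0 <= K * n%:R `^ (- d) by rewrite mulr_ge0 ?(ltW p0)// /K; lra.
by lra.
Qed.

End real_sequences.

(** * Decay of all moments from the one-step inequality *)

Section moment_recursion.
Context {R : realType}.
Variables (u : nat -> nat -> R) (gamma : nat -> R) (c alpha : R).
Hypotheses (c0 : 0 < c) (alpha_range : 2^-1 < alpha < 1).
Hypothesis gammaE : forall n, (1 <= n)%N -> gamma n = c * n%:R `^ (- alpha).
Hypothesis u_ge0 : forall p n, 0 <= u p n.
Hypothesis u0 : forall n, (1 <= n)%N -> u 0 n <= 1.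
Hypothesis step : forall p, exists C kappa : R, [/\ 0 < C, 0 < kappa &
  forall (B : R) (q n : nat), 0 <= B <= 1 -> (1 <= n)%N ->
    u p.+1 n.+1 <= (1 + C * gamma n ^+ 2 - kappa * gamma n * B) * u p.+1 n
      + kappa * gamma n * B ^+ (2 * q).+1 * u (p.+1 + q) n
      + C * gamma n ^+ 2 * u p n + C * gamma n ^+ (2 * p.+1)].

Let powRn (n : nat) (x : R) (k : nat) : n%:R `^ x ^+ k = n%:R `^ (k%:R * x).
Proof. by rewrite mulrC powRrM powR_mulrn ?powR_ge0. Qed.

Let powRnD (n : nat) (x y : R) : (1 <= n)%N ->
  n%:R `^ (x + y) = n%:R `^ x * n%:R `^ y.
Proof. by move=> n1; rewrite powRD// pnatr_eq0 -lt0n n1 implybT. Qed.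

Let powRn_le (n : nat) (x y : R) : (1 <= n)%N -> x <= y ->
  n%:R `^ x <= n%:R `^ y.
Proof. by move=> n1; apply: ler_powR; rewrite ler1n. Qed.

(** For [B = 0] only terms of order [gamma ^ 2] or smaller perturb [u p.+1], and they are summable
    as [2 * alpha > 1]. The lower moment, bounded by induction, joins the forcing term. *)
Lemma moment_bounded p : exists2 K, 0 < K & forall n, (1 <= n)%N -> u p n <= K.
Proof.
have [al ah] := andP alpha_range.
elim: p => [|p [K K0 IH]]; first by exists 1.
have [C [kappa [C0 k0 hstep]]] := step p.
pose D := C * c ^+ 2 * (1 + K) + C * c ^+ (2 * p.+1).
have D1 : 0 <= C * c ^+ 2 by rewrite mulr_ge0 ?sqr_ge0// ltW.
have D2 : 0 <= C * c ^+ (2 * p.+1) by rewrite mulr_ge0 ?exprn_ge0// ltW.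
have DK : 0 <= C * c ^+ 2 * K by rewrite mulr_ge0// ltW.
apply: (@summable_growth_bounded _ _ (2 * alpha) D) => //; [lra|by rewrite /D; lra|].
move=> n n1; have := hstep 0 0%N n; rewrite lexx ler01 => /(_ isT n1).
rewrite !mulr0 subr0 !mul0r addr0 gammaE// !exprMn !powRn.
have -> : (2%:R * - alpha) = - (2 * alpha) by rewrite mulrN.
set X := n%:R `^ (- (2 * alpha)).
have X0 : 0 <= X by exact: powR_ge0.
have hX : n%:R `^ ((2 * p.+1)%:R * - alpha) <= X.
  apply: powRn_le => //; rewrite mulrN lerN2 ler_wpM2r//; first by lra.
  by rewrite ler_nat mulnS leq_addr.
have XU : 0 <= X * u p.+1 n by rewrite mulr_ge0.
have e1 := ler_wpM2l D2 hX.
have e2 := ler_wpM2l (mulr_ge0 D1 X0) (IH _ n1).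
have e3 := mulr_ge0 DK XU; have e4 := mulr_ge0 D2 XU.
have e5 := mulr_ge0 D1 X0.
rewrite /D; lra.
Qed.

(** For [B = n ^ (- s)] the contraction has exponent [alpha + s], and [2 * alpha + p * (alpha - s) =
    (alpha + s) + (p + 1) * (alpha - s)]: the term [gamma ^ 2 * u p] thus gains exactly one factor
    [n ^ (- (alpha - s))] per order. The assumption on the tail gives the higher moment the same
    size. Both passes are instances, the second with [s = 0]. *)
Lemma moment_rate_of_tail s : 0 <= s -> s < alpha -> alpha + s < 1 ->
  (forall p, exists (q : nat) (K : R), 0 <= K /\ forall n, (1 <= n)%N ->
     n%:R `^ (- s) ^+ (2 * q) * u (p + q) n <= K * n%:R `^ (- (p%:R * (alpha - s)))) ->
  forall p, exists2 K, 0 < K &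
    forall n, (1 <= n)%N -> u p n <= K * n%:R `^ (- (p%:R * (alpha - s))).
Proof.
move=> s0 sa as1 tail; have [al ah] := andP alpha_range.
elim=> [|p [K K0 IH]].
  by exists 1 => // n n1; rewrite mul0r oppr0 powRr0 mulr1 u0.
have [C [kappa [C0 k0 hstep]]] := step p.
have [q [K' [K'0 hq]]] := tail p.+1.
(* Past [N] the growth [C * gamma ^ 2] eats at most half of the contraction, which leaves the
   constant [kappa * c / 2] below. *)
have [N hN] : exists N : nat, forall n : nat, (N <= n)%N ->
    n%:R `^ (- (alpha - s)) <= kappa / (2 * C * c).
  by apply: powR_small; rewrite ?subr_gt0// divr_gt0// !mulr_gt0.
pose D := kappa * c * K' + C * c ^+ 2 * K + C * c ^+ (2 * p.+1).
have D0 : 0 <= kappa * c * K' by rewrite !mulr_ge0// ltW.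
have D1 : 0 <= C * c ^+ 2 by rewrite mulr_ge0 ?sqr_ge0// ltW.
have D2 : 0 <= C * c ^+ (2 * p.+1) by rewrite mulr_ge0 ?exprn_ge0// ltW.
have DK : 0 <= C * c ^+ 2 * K by rewrite mulr_ge0// ltW.
set b := p.+1%:R * (alpha - s).
have pE : p.+1%:R = p%:R + 1 :> R by rewrite -natr1.
have p0 : (0 : R) <= p%:R by [].
have ps0 : 0 <= p%:R * s by rewrite mulr_ge0.
have pa0 : 0 <= p%:R * (alpha - s) by rewrite mulr_ge0// subr_ge0 ltW.
apply: (@contraction_rate _ _ (alpha + s) b (kappa * c / 2) D N.+1) => //.
- by rewrite as1 andbT; lra.
- by rewrite /b pE; lra.
- by rewrite divr_gt0// mulr_gt0.
- by rewrite /D; lra.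
move=> n Nn; have n1 : (1 <= n)%N by apply: leq_trans Nn.
have s01 : 0 <= n%:R `^ (- s) <= 1.
  by rewrite powR_ge0/= -[leRHS](powRr0 n%:R) powRn_le// oppr_le0.
have := hstep _ q n s01 n1.
have := hN n (ltnW Nn); rewrite ler_pdivlMr ?mulr_gt0// => hn.
have := hq _ n1; have := IH _ n1; have := u_ge0 p.+1 n.
rewrite gammaE// [_ ^+ (2 * q).+1]exprSr !exprMn.
move: (u p.+1 n) (u p.+1 n.+1) (u (p.+1 + q) n) (u p n) => U U' V W U0 hW hV.
set E := n%:R `^ (- (alpha + s)).
set F := n%:R `^ (- (alpha + s + b)).
have EE : n%:R `^ (- alpha) * n%:R `^ (- s) = E by rewrite -powRnD// -opprD.
have FE : E * n%:R `^ (- b) = F by rewrite -powRnD// -opprD.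
have GE : n%:R `^ (- alpha) ^+ 2 = E * n%:R `^ (- (alpha - s)).
  by rewrite powRn -powRnD//; congr powR; ring.
have HE : n%:R `^ (- alpha) ^+ 2 * n%:R `^ (- (p%:R * (alpha - s))) = F.
  by rewrite powRn -powRnD//; congr powR; rewrite /b pE; ring.
have IE : n%:R `^ (- alpha) ^+ (2 * p.+1) <= F.
  rewrite powRn; apply: powRn_le => //; rewrite natrM pE /b pE.
  have : 0 <= p%:R * alpha by rewrite mulr_ge0//; lra.
  lra.
have E0 : 0 <= E by exact: powR_ge0.
have -> : (1 + C * (c ^+ 2 * n%:R `^ (- alpha) ^+ 2) -
     kappa * (c * n%:R `^ (- alpha)) * n%:R `^ (- s)) * U =
   (1 + C * c ^+ 2 * n%:R `^ (- alpha) ^+ 2 - kappa * c * E) * U.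
  by rewrite -EE; ring.
set y := n%:R `^ (- s) ^+ (2 * q) in hV *.
have -> : kappa * (c * n%:R `^ (- alpha)) * (y * n%:R `^ (- s)) * V =
   kappa * c * E * (y * V) by rewrite -EE; ring.
have -> : C * (c ^+ 2 * n%:R `^ (- alpha) ^+ 2) * W =
  C * c ^+ 2 * (n%:R `^ (- alpha) ^+ 2 * W) by ring.
have tV : kappa * c * E * (y * V) <= kappa * c * K' * F.
  have := ler_wpM2l (_ : 0 <= kappa * c * E) hV.
  rewrite -FE => h; apply: le_trans (h _) _; last by rewrite le_eqVlt; apply/orP; left; apply/eqP; ring.
  by rewrite !mulr_ge0// ltW.
have tW : C * c ^+ 2 * (n%:R `^ (- alpha) ^+ 2 * W) <= C * c ^+ 2 * K * F.
  rewrite -[leRHS]mulrA; apply: ler_wpM2l => //; rewrite -HE mulrCA.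
  by apply: ler_wpM2l => //; exact: sqr_ge0.
have tI := ler_wpM2l D2 IE.
have tC : C * c ^+ 2 * n%:R `^ (- alpha) ^+ 2 * U <= kappa * c / 2 * E * U.
  apply: ler_wpM2r => //; rewrite GE.
  move: hn; set Y := _ `^ _ => hn.
  have := ler_wpM2l (mulr_ge0 (ltW c0) E0) hn; lra.
rewrite /D mulrDl mulrDl => hU; lra.
Qed.

Lemma moment_rate p : exists2 K, 0 < K &
  forall n, (1 <= n)%N -> u p n <= K * n%:R `^ (- (p%:R * alpha)).
Proof.
have [al ah] := andP alpha_range.
pose s := (1 - alpha) / 2.
have s0 : 0 < s by rewrite /s; lra.
have rate1 k : exists2 K, 0 < K &
    forall n, (1 <= n)%N -> u k n <= K * n%:R `^ (- (k%:R * (alpha - s))).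
  apply: moment_rate_of_tail => [|||{}k]; [exact: ltW|by rewrite /s; lra..|].
  (* Now [q * s > k], so the damping [n ^ (- 2 q s)] of a merely bounded moment is already below the
     target rate. *)
  pose q := (Num.truncn (k%:R / s)).+1.
  have [K K0 hK] := moment_bounded (k + q).
  exists q, K; split; first exact: ltW.
  move=> n n1; rewrite mulrC; apply: ler_pM => //; rewrite ?exprn_ge0 ?powR_ge0 ?hK//.
  rewrite powRn; apply: powRn_le => //; rewrite mulrN lerN2.
  have : k%:R / s < q%:R by exact: truncnS_gt.
  rewrite ltr_pdivrMr// natrM => h.
  have : k%:R * (alpha - s) <= k%:R * 1 by apply: ler_wpM2l => //; lra.
  by have : 0 < q%:R * s; [rewrite mulr_gt0// ltr0n|lra].
have := @moment_rate_of_tail 0; rewrite subr0 addr0; apply => //; first by lra.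
(* Here [B = 1] damps nothing; instead [q * (alpha - s) > k] makes the first-pass rate of order
   [k + q] at least as good as [n ^ (- k alpha)]. *)
move=> k; pose q := (Num.truncn (k%:R / (alpha - s))).+1.
have [K K0 hK] := rate1 (k + q)%N.
exists q, K; split; first exact: ltW.
move=> n n1; rewrite oppr0 powRr0 expr1n mul1r; apply: (le_trans (hK _ n1)).
rewrite ler_pM2l//; apply: powRn_le => //; rewrite lerN2.
have as0 : 0 < alpha - s by rewrite /s; lra.
have : k%:R / (alpha - s) < q%:R by exact: truncnS_gt.
rewrite ltr_pdivrMr// natrD => h.
have : k%:R * alpha <= k%:R * 1 by apply: ler_wpM2l => //; lra.
have : 0 <= k%:R * (alpha - s) by rewrite mulr_ge0// ltW.
lra.
Qed.

End moment_recursion.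

(** * Drift *)

Section inner_product.
Context {R : realType} {H : completeNormedModType R} {dot : {dot H for idfun}}.
Hypothesis Hnorm : norm_from_dot dot.
Implicit Types u v w : H.

Lemma dotC u v : dot u v = dot v u.
Proof. by rewrite hermC expr0 mul1r. Qed.

Lemma dotDl u v w : dot (u + v) w = dot u w + dot v w.
Proof. exact: linearDl. Qed.

Lemma dotBl u v w : dot (u - v) w = dot u w - dot v w.
Proof. exact: linearBl. Qed.

Lemma dotZl (a : R) u w : dot (a *: u) w = a * dot u w.
Proof. exact: linearZl_LR. Qed.

Lemma dotDr u v w : dot w (u + v) = dot w u + dot w v.
Proof. by rewrite !(dotC w) dotDl. Qed.

Lemma dotBr u v w : dot w (u - v) = dot w u - dot w v.
Proof. by rewrite !(dotC w) dotBl. Qed.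

Lemma dotZr (a : R) u w : dot w (a *: u) = a * dot w u.
Proof. by rewrite !(dotC w) dotZl. Qed.

Lemma dot0l u : dot 0 u = 0.
Proof. by rewrite -(scale0r u) dotZl mul0r. Qed.

Lemma sqr_norm_dot u : `|u| ^+ 2 = dot u u.
Proof.
rewrite Hnorm sqr_sqrtr//.
have [->|u0] := eqVneq u 0; first by rewrite dot0l.
exact/ltW/neq0_dnorm_gt0.
Qed.

Lemma sqr_normB u v : `|u - v| ^+ 2 = `|u| ^+ 2 - 2 * dot v u + `|v| ^+ 2.
Proof.
by rewrite !sqr_norm_dot dotBl !dotBr (dotC u v); ring.
Qed.

Lemma sqr_normD u v : `|u + v| ^+ 2 = `|u| ^+ 2 + 2 * dot v u + `|v| ^+ 2.
Proof.
by rewrite !sqr_norm_dot dotDl !dotDr (dotC u v); ring.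
Qed.

(** Cauchy-Schwarz, obtained by squaring the triangle inequalities for [v + u] and [v - u]. *)
Lemma normr_dot_le u v : `|dot u v| <= `|u| * `|v|.
Proof.
have h1 := sqr_normD v u; have h2 := sqr_normB v u.
have le1 : `|v + u| ^+ 2 <= (`|v| + `|u|) ^+ 2 by rewrite ler_sqr ?nnegrE// ler_normD.
have le2 : `|v - u| ^+ 2 <= (`|v| + `|u|) ^+ 2 by rewrite ler_sqr ?nnegrE// ler_normB.
rewrite ler_norml; lra.
Qed.

Lemma dot_le u v : dot u v <= `|u| * `|v|.
Proof. by apply: le_trans (normr_dot_le u v); exact: ler_norm. Qed.

(* With [x = |u|] and [y = |v|], every remainder monomial [x ^ i * y ^ j], where
   [i + j = k] and [j >= 2], is at most [x ^ (k - 2) * y ^ 2 + y ^ k]. *)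
Lemma norm_sub_pow_le (p : nat) : exists2 C : R, 0 < C & forall u v,
  `|u - v| ^+ (2 * p.+1) <= `|u| ^+ (2 * p.+1)
     - 2 * p.+1%:R * `|u| ^+ (2 * p) * dot v u
     + C * (`|u| ^+ (2 * p) * `|v| ^+ 2 + `|v| ^+ (2 * p.+1)).
Proof.
elim: p => [|p [C C0 IH]].
  exists 1 => // u v; rewrite !muln1 !muln0 !expr0 mulr1 mul1r mul1r sqr_normB.
  by have := sqr_ge0 `|v|; lra.
(* In units of [S] below, the step creates 1 from [x ^ q * y ^ 2], [6 * p.+1] (rounded up) from [T2]
   and [T3], and [8 * C] from the previous remainder in [T1]. *)
exists (1 + 8 * p.+1%:R + 8 * C) => [|u v].
  by have : (0 : R) <= p.+1%:R by []; lra.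
have h2 : `|u - v| ^+ 2 <= 2 * (`|u| ^+ 2 + `|v| ^+ 2).
  have /andP[h _] : - (`|v| * `|u|) <= dot v u <= `|v| * `|u|.
    by rewrite -ler_norml normr_dot_le.
  have := sqr_ge0 (`|u| - `|v|); rewrite sqr_normB; lra.
rewrite mulnS exprD mulrC.
apply: (le_trans (ler_wpM2r (sqr_ge0 _) (IH u v))).
set q := (2 * p.+1)%N; have q2 : q = (2 * p).+2 by rewrite /q mulnS.
set r := (2 * p)%N in q2 *; set t := dot v u.
have tE : `|t| <= `|v| * `|u| by exact: normr_dot_le.
move: h2; rewrite sqr_normB -/t.
move: tE; rewrite ler_norml => /andP[t1 t2].
have := normr_ge0 u; have := normr_ge0 v.
move: (`|u|) (`|v|) t t1 t2 => x y t t1 t2 y0 x0 h2.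
pose S := x ^+ q * y ^+ 2 + y ^+ (2 + q).
have mono i j : (i + j = 2 + q)%N -> (2 <= j)%N -> x ^+ i * y ^+ j <= S.
  move=> ij j2; have [xy|yx] := leP x y.
    apply: (@le_trans _ _ (y ^+ (2 + q))); last first.
      by rewrite /S lerDr mulr_ge0// exprn_ge0.
    rewrite -ij exprD; apply: ler_wpM2r; first exact: exprn_ge0.
    by apply: lerXn2r.
  apply: (@le_trans _ _ (x ^+ q * y ^+ 2)); last first.
    by rewrite /S lerDl exprn_ge0.
  have -> : q = (i + (j - 2))%N.
    by apply/eqP; rewrite -(eqn_add2l 2) -ij addnCA subnKC.
  rewrite -[j in leLHS](subnK j2) !exprD -mulrA; apply: ler_wpM2l.
    exact: exprn_ge0.
  apply: ler_wpM2r; first exact: exprn_ge0.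
  by apply: lerXn2r; rewrite // ?nnegrE ltW.
have m1 := mono q 2 (addnC _ _) isT.
have m2 : x ^+ r * y ^+ 2 * x ^+ 2 <= S.
  by rewrite mulrAC -exprD; apply: mono => //; rewrite q2 !addn2.
have m3 : x ^+ r * y ^+ 2 * y ^+ 2 <= S.
  by rewrite -mulrA -exprD; apply: mono => //; rewrite q2 addn4.
have m4 : y ^+ q * x ^+ 2 <= S by rewrite mulrC; apply: mono; rewrite ?q2.
have m5 : y ^+ q * y ^+ 2 <= S.
  by rewrite -exprD addnC -[leLHS]mul1r -(expr0 x); apply: mono.
have m6 : x ^+ r.+1 * y ^+ 3 <= S by apply: mono => //; rewrite q2 addn3.
have xr0 : 0 <= x ^+ r by exact: exprn_ge0.
have T1 : C * (x ^+ r * y ^+ 2 + y ^+ q) * (x ^+ 2 - 2 * t + y ^+ 2) <= 8 * C * S.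
  have : (x ^+ r * y ^+ 2 + y ^+ q) * (x ^+ 2 - 2 * t + y ^+ 2) <= 8 * S.
    apply: (@le_trans _ _ ((x ^+ r * y ^+ 2 + y ^+ q) * (2 * (x ^+ 2 + y ^+ 2)))).
      by apply: ler_wpM2l => //; rewrite addr_ge0 ?mulr_ge0 ?exprn_ge0.
    by lra.
  by move=> h; rewrite -mulrA (mulrC 8) -mulrA ler_pM2l.
have T2 : x ^+ r * (t * t) <= S.
  have tt : t * t <= (y * x) * (y * x).
    have : 0 <= (y * x - t) * (y * x + t) by apply: mulr_ge0; lra.
    by lra.
  apply: (le_trans (ler_wpM2l xr0 tt)).
  by rewrite (_ : x ^+ r * (y * x * (y * x)) = x ^+ r * y ^+ 2 * x ^+ 2)//; ring.
have T3 : - (x ^+ r * t * y ^+ 2) <= S.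
  apply: le_trans m6; rewrite -mulNr -mulrN [leRHS](_ : _ = x ^+ r * (y * x) * y ^+ 2).
    by apply: ler_wpM2r; [exact: sqr_ge0|apply: ler_wpM2l => //; lra].
  by rewrite exprS; ring.
have P0 : (0 : R) <= p.+1%:R by [].
have E : (2 + q)%N = q.+2 by [].
have xq : x ^+ q = x ^+ r * x ^+ 2 by rewrite q2 -exprD addn2.
have xq2 : x ^+ (2 + q) = x ^+ q * x ^+ 2 by rewrite -exprD addnC.
rewrite -/S -[in X in _ <= _ - X * _ * _ + _]natr1 [in leLHS]mulrDl.
have U2 := ler_wpM2l P0 T2; have U3 := ler_wpM2l P0 T3.
have S1 : x ^+ q * y ^+ 2 <= S by [].
rewrite xq2.
(* The cross term [- 2 * x ^ q * t] raises the coefficient of the linear term to the next order; the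
   last three terms are remainders. *)
have -> : (x ^+ q - 2 * p.+1%:R * x ^+ r * t) * (x ^+ 2 - 2 * t + y ^+ 2) =
  x ^+ q * x ^+ 2 - 2 * (p.+1%:R + 1) * x ^+ q * t + x ^+ q * y ^+ 2
  + 4 * (p.+1%:R * (x ^+ r * (t * t))) + 2 * (p.+1%:R * - (x ^+ r * t * y ^+ 2)).
  by rewrite xq; ring.
have PS : 0 <= p.+1%:R * S.
  by rewrite mulr_ge0// (le_trans _ m5)// mulr_ge0// exprn_ge0.
lra.
Qed.

End inner_product.

(** * Tangent inequality and monotonicity of the gradient *)

Section convex_gradient.
Context {R : realType} {H : completeNormedModType R} {dot : {dot H for idfun}}.
Implicit Types (G : H -> R) (h k v : H).

(** By convexity the difference quotient from [h] towards [k] is at most [G k - G h] for every step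
    [t] in []0, 1]]; let [t] tend to 0 from the right. *)
Lemma convex_gradient_le G h v k : convex_function [set: H] G ->
  is_gradient dot G h v -> G h + dot v (k - h) <= G k.
Proof.
move=> Gconv [dG dGE].
have /cvg_ex[l /= hl] : derivable (G : H -> R^o) h (k - h).
  exact: diff_derivable.
have lE : l = dot v (k - h).
  have -> : dot v (k - h) = 'd (G : H -> R^o) h (k - h) by rewrite dGE.
  by rewrite -deriveE//; apply/esym/cvg_lim.
rewrite -lE -lerBrDl.
have hr : (fun t : R => t^-1 *: (((G : H -> R^o) \o shift h) (t *: (k - h)) - G h))
   @ (0 : R)^'+ --> l.
  apply: cvg_trans hl; apply: cvg_app => A; rewrite /dnbhs /at_right.
  apply: within_subset => t /= t0.
  by rewrite gt_eqF.
apply: (cvgr_to_le hr).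
near=> t.
have t0 : 0 < t by near: t; exact: nbhs_right_gt.
have t1 : t <= 1 by near: t; exact: nbhs_right_ltW.
have t01 : 0 <= t <= 1 by rewrite (ltW t0).
have := Gconv (Itv01 (ltW t0) t1) k h (mem_setT _) (mem_setT _).
rewrite /conv/= => hc.
have hx : t *: (k - h) + h = t *: k + (1 - t) *: h.
  by rewrite scalerBl scale1r scalerBr -addrA (addrC _ h).
rewrite hx /GRing.scale/= mulrC ler_pdivrMr//.
have : G (t *: k + (1 - t) *: h) <= t * G k + (1 - t) * G h by exact: hc.
by lra.
Unshelve. all: by end_near. Qed.

(** Add the tangent inequalities at [h] and at [k]. *)
Lemma convex_gradient_mono G (gradG : H -> H) h k : convex_function [set: H] G ->
  (forall x, is_gradient dot G x (gradG x)) ->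
  dot (gradG h) (k - h) <= dot (gradG k) (k - h).
Proof.
move=> Gconv gG.
have h1 := convex_gradient_le k Gconv (gG h).
have h2 := convex_gradient_le h Gconv (gG k).
have := dotBr k h (gradG k); have := dotBr h k (gradG k); lra.
Qed.

End convex_gradient.

(** * Coercivity of an operator with an orthonormal eigenbasis *)

Section eigenbasis.
Context {R : realType} {H : completeNormedModType R} {dot : {dot H for idfun}}.
Hypothesis Hnorm : norm_from_dot dot.

(** Repeated vectors are merged, so that orthonormality makes quadratic forms diagonal sums. *)
Lemma linear_span_uniq (B : set H) v : linear_span B v ->
  exists (s : seq H) (c : H -> R),
    [/\ uniq s, forall b, b \in s -> B b & v = \sum_(b <- s) c b *: b].
Proof.
move=> [n [a [b [Bb ->]]]].
pose s := undup [seq b i | i : 'I_n].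
exists s, (fun x => \sum_(i < n | b i == x) a i); split.
- exact: undup_uniq.
- by move=> x; rewrite mem_undup => /mapP[i _ ->].
- under [RHS]eq_bigr do rewrite scaler_suml big_mkcond/=.
  rewrite exchange_big/=; apply: eq_bigr => i _.
  have bs : b i \in s by rewrite mem_undup map_f// mem_enum.
  rewrite (bigD1_seq (b i) bs (undup_uniq _))/= eqxx.
  by rewrite big1 ?addr0// => x; rewrite eq_sym => /negbTE ->.
Qed.

(** On finite combinations of basis vectors both sides are diagonal and compare term by term. The
    set where the inequality fails is open, so if nonempty it would meet the dense span. *)
Lemma eigenbasis_coercive (A : {linear H -> H}) (lam : R) : continuous A ->
  has_eigenbasis dot A -> (lam%:E <= inf_eigenvalues A)%E ->
  forall u, lam * `|u| ^+ 2 <= dot (A u) u.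
Proof.
move=> cA [B [[Bon Bdense] Beig]] lamA.
have [l hl] : exists l : H -> R, forall u, B u -> is_eigenvector A (l u) u.
  have /choice[l hl] : forall u, exists l : R, B u -> is_eigenvector A l u.
    move=> u; have [/Beig[l ?]|nB] := pselect (B u); first by exists l.
    by exists 0.
  by exists l.
have lam_le u : B u -> lam <= l u.
  move=> Bu; rewrite -lee_fin; apply: (le_trans lamA).
  by apply: ereal_inf_lbound; exists (l u) => //; exists u; exact: hl.
have span_le u : linear_span B u -> lam * `|u| ^+ 2 <= dot (A u) u.
  move=> /linear_span_uniq[s [c [us sB ->]]].
  have dsum (x : H) (F : H -> H) : dot (\sum_(b <- s) F b) x = \sum_(b <- s) dot (F b) x.
    by elim/big_rec2: _ => [|b y1 y2 _ <-]; rewrite ?dot0l ?dotDl.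
  have ortho (d : H -> R) :
      dot (\sum_(b <- s) d b *: b) (\sum_(b <- s) c b *: b) = \sum_(b <- s) d b * c b.
    rewrite dsum; apply: eq_big_seq => b bs.
    rewrite dotZl dotC dsum (bigD1_seq b)//= dotZl Bon ?eqxx ?mulr1; [|exact: sB..].
    rewrite big_seq_cond big1 ?addr0// => b' /andP[b's b'b].
    by rewrite dotZl Bon ?(negbTE b'b) ?mulr0//; exact: sB.
  rewrite (sqr_norm_dot Hnorm) ortho.
  have -> : A (\sum_(b <- s) c b *: b) = \sum_(b <- s) (l b * c b) *: b.
    rewrite linear_sum; apply: eq_big_seq => b /sB /hl[_ e].
    by rewrite linearZ/= e scalerA mulrC.
  rewrite ortho mulr_sumr big_seq [leRHS]big_seq; apply: ler_sum => b bs.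
  by rewrite -mulrA; apply: ler_wpM2r; [rewrite -expr2 sqr_ge0|apply/lam_le/sB].
(* Polarisation reduces continuity of the quadratic form to that of [A] and of the norm. *)
have polar u : dot (A u) u = (`|u + A u| ^+ 2 - `|u| ^+ 2 - `|A u| ^+ 2) / 2.
  by rewrite (sqr_normD Hnorm); field.
move=> u; rewrite -subr_ge0; apply: contrapT => /negP; rewrite -ltNge => u0.
pose f := fun x : H => dot (A x) x - lam * `|x| ^+ 2.
have cf : continuous f.
  move=> x; rewrite /f.
  under eq_fun do rewrite polar.
  have c1 : `|y + A y| @[y --> x] --> `|x + A x|.
    by apply: cvg_norm; apply: cvgD; [exact: cvg_id|exact: cA].
  have c2 : `|A y| @[y --> x] --> `|A x| by apply: cvg_norm; exact: cA.
  have c3 : `|y| @[y --> x] --> `|x| by apply: cvg_norm; exact: cvg_id.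
  apply: cvgB; last by apply: cvgM; [exact: cvg_cst|exact: cvgM].
  apply: cvgM; last exact: cvg_cst.
  by apply: cvgB; [apply: cvgB|]; exact: cvgM.
have Of : open (f @^-1` [set y | y < 0]).
  by apply: open_comp; [move=> x _; exact: cf|exact: open_lt].
have [x [/= fx /span_le]] := Bdense _ (ex_intro _ u u0) Of.
by rewrite -subr_ge0 leNgt => /negP; apply.
Qed.

End eigenbasis.

(** * Lower bound on the drift, first near [m], then everywhere *)

Section drift.
Context {R : realType} {H : completeNormedModType R} {dot : {dot H for idfun}}.
Hypothesis Hnorm : norm_from_dot dot.
Variables (G : H -> R) (gradG Gam : H -> H) (m : H).
Hypothesis Gconv : convex_function [set: H] G.
Hypothesis gG : forall h, is_gradient dot G h (gradG h).
Hypothesis hess : is_hessian dot gradG m Gam.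
Hypothesis eigb : has_eigenbasis dot Gam.
Hypothesis eig_gt0 : (0 < inf_eigenvalues Gam)%E.
Variables (e C : R).
Hypothesis (e0 : 0 < e) (C0 : 0 < C).
Hypothesis taylor : forall h, `|h - m| <= e ->
  `|gradG h - Gam (h - m)| <= C * `|h - m| ^+ 2.

Lemma local_drift : exists lam d : R, [/\ 0 < lam, 0 < d &
  forall h, `|h - m| <= d -> lam * `|h - m| ^+ 2 <= dot (gradG h) (h - m)].
Proof.
(* The infimum is [+oo] when there is no eigenvalue, as in the zero space; any positive number then
   works. *)
have [lam lam0 lamle] : exists2 lam : R, 0 < lam & (lam%:E <= inf_eigenvalues Gam)%E.
  case: (inf_eigenvalues Gam) eig_gt0 => [x|_|//]; first by rewrite lte_fin; exists x.
  by exists 1 => //; rewrite leey.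
have coer u : lam * `|u| ^+ 2 <= dot (Gam u) u.
  (* [Gam] is a bare function; written as the differential it is linear and continuous. *)
  case: hess => -[dg dgE] _; move: eigb lamle; rewrite -dgE => eb le.
  exact: eigenbasis_coercive (diff_continuous dg) eb le u.
(* This radius keeps the cubic Taylor error below [lam / 2 * r ^ 2], half of the coercivity. *)
exists (lam / 2), (Num.min e (lam / (2 * C))); split; first by rewrite divr_gt0.
  by rewrite lt_min e0/= divr_gt0// mulr_gt0.
move=> h; rewrite le_min => /andP[he].
rewrite ler_pdivlMr ?mulr_gt0// => hl.
have := coer (h - m).
have : dot (Gam (h - m)) (h - m) - dot (gradG h) (h - m) <= C * `|h - m| ^+ 2 * `|h - m|.
  rewrite -dotBl; apply: le_trans (dot_le Hnorm _ _) _.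
  by rewrite distrC; apply: ler_wpM2r => //; exact: taylor.
have : C * `|h - m| ^+ 2 * `|h - m| <= lam / 2 * `|h - m| ^+ 2.
  rewrite mulrAC; apply: ler_wpM2r; first exact: sqr_ge0.
  by lra.
by lra.
Qed.

(* Outside a ball around [m] the lower bound survives with linear growth, because
   the derivative of [G] along a ray issued from [m] is nondecreasing. *)
Lemma global_drift : exists2 c : R, 0 < c & forall h,
  c * Num.min `|h - m| (`|h - m| ^+ 2) <= dot (gradG h) (h - m).
Proof.
have [lam [d [lam0 d0 loc]]] := local_drift.
exists (Num.min lam (lam * d)) => [|h]; first by rewrite lt_min lam0 mulr_gt0.
have r0 := normr_ge0 (h - m).
have min0 : 0 <= Num.min `|h - m| (`|h - m| ^+ 2) by rewrite le_min r0 sqr_ge0.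
have [hd|hd] := leP `|h - m| d.
  apply: le_trans (loc _ hd); apply: ler_pM => //; last by rewrite ge_min lexx orbT.
    by rewrite le_min !ltW ?mulr_gt0.
  by rewrite ge_min lexx.
have rp : 0 < `|h - m| by exact: lt_trans hd.
(* [k] is the point of the segment from [m] to [h] at distance [d] from [m]; there the local bound
   gives [lam * d ^ 2], and dividing by [s] gives [lam * d * r]. *)
pose s := d / `|h - m|.
have s0 : 0 < s by rewrite divr_gt0.
have s1 : s < 1 by rewrite ltr_pdivrMr// mul1r.
pose k := m + s *: (h - m).
have km : k - m = s *: (h - m) by rewrite /k addrAC subrr add0r.
have kd : `|k - m| = d by rewrite km normrZ gtr0_norm// divfK// gt_eqF.
have hk : h - k = (1 - s) *: (h - m) by rewrite scalerBl scale1r /k opprD addrA.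
have := convex_gradient_mono k h Gconv gG.
rewrite hk !dotZr ler_pM2l ?subr_gt0//; apply: le_trans.
have := loc k; rewrite kd => /(_ (lexx _)); rewrite km dotZr => hloc.
apply: (@le_trans _ _ (lam * d * `|h - m|)).
  apply: ler_pM => //; last by rewrite ge_min lexx.
    by rewrite le_min !ltW ?mulr_gt0.
  by rewrite ge_min lexx orbT.
have sE : d = s * `|h - m| by rewrite divfK// gt_eqF.
rewrite -(ler_pM2l s0); apply: le_trans hloc.
by rewrite [in leRHS]expr2 [in X in _ <= _ * (X * _)]sE; lra.
Qed.

End drift.

(** If [B * r <= 1], then [B * r ^ 2] is already below both [r] and [r ^ 2]; otherwise the
    subtracted term exceeds it, being [B * r ^ 2] times [(B * r) ^ (2 q)]. The power of [r] is even
    so that integration yields one of the moments studied. *)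
Lemma min_drift_ge (R : realType) (B r : R) (q : nat) : 0 <= B <= 1 -> 0 <= r ->
  B * r ^+ 2 - B ^+ (2 * q).+1 * r ^+ (2 * q.+1) <= Num.min r (r ^+ 2).
Proof.
move=> /andP[B0 B1] r0.
have Y0 : 0 <= B ^+ (2 * q).+1 * r ^+ (2 * q.+1) by rewrite mulr_ge0// exprn_ge0.
rewrite le_min; apply/andP; split; last first.
  by have := ler_wpM2r (sqr_ge0 r) B1; lra.
have [Br|Br] := leP (B * r) 1.
  by have := ler_wpM2r r0 Br; rewrite expr2; lra.
apply: (le_trans _ r0); rewrite subr_le0.
have -> : B ^+ (2 * q).+1 * r ^+ (2 * q.+1) = B * r ^+ 2 * (B * r) ^+ (2 * q).
  by rewrite mulnS exprS (exprD r) exprMn; ring.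
rewrite ler_peMr ?mulr_ge0 ?sqr_ge0//.
by rewrite exprn_ege1// ltW.
Qed.

(** * Measurability and independence *)

Section borel_measurability.
Context {R : realType} {H : completeNormedModType R}.

Lemma separable_dense_sequence : separable_space H ->
  exists e : nat -> H, forall (x : H) (r : R), 0 < r -> exists i, `|x - e i| < r.
Proof.
move=> [D cD dD].
have dense_ball (x : H) (r : R) : 0 < r -> exists2 y, D y & `|x - y| < r.
  move=> r0; have [||y [xy Dy]] := dD (ball x r).
  - by exists x; exact: ballxx.
  - exact: ball_open.
  by exists y => //; move: xy; rewrite -ball_normE.
move: cD => /pfcard_geP[D0|/unsquash e].
  by have [y] := dense_ball 0 1 ltr01; rewrite D0.
exists e => x r /(dense_ball x)[y Dy xy].
by have [i _ ei] := 'oinvP_e Dy; exists i; rewrite ei.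
Qed.

Lemma measurable_continuous_borel (K : completeNormedModType R) (f : H -> K) :
  continuous f -> measurable_fun [set: borel H] (f : borel H -> borel K).
Proof.
move=> cf; apply: (@measurability _ _ (borel H) (borel K) setT f (@open K)) => // _ [U oU <-].
rewrite setTI; apply: sub_sigma_algebra.
by apply: open_comp => // x _; exact: cf.
Qed.

Lemma measurable_continuous_real (f : H -> R) :
  continuous f -> measurable_fun [set: borel H] (f : borel H -> R).
Proof.
move=> cf; apply: (measurability _ (RGenInftyO.measurableE R)).
move=> _ [_ [a ->] <-]; rewrite setTI; apply: sub_sigma_algebra.
by apply: open_comp => [x _|]; [exact: cf|exact: interval_open].
Qed.

(* The Borel sigma-algebra of [H * H] is the product one only because [H] is
   separable: the preimage of an open set is a countable union of rectangles. *)
Lemma measurable_addB d (T : measurableType d) (f g : T -> H) : separable_space H ->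
  measurable_fun [set: T] (f : T -> borel H) ->
  measurable_fun [set: T] (g : T -> borel H) ->
  measurable_fun [set: T] ((fun x => f x + g x) : T -> borel H).
Proof.
move=> /separable_dense_sequence[e he] mf mg.
apply: (@measurability _ _ T (borel H) setT (fun x => f x + g x) (@open H)) => // _ [U oU <-]; rewrite setTI.
pose rad (n : nat) : R := n.+1%:R^-1.
have rad0 n : 0 < rad n by rewrite invr_gt0 ltr0n.
(* A triple selects two centres and a radius. Rejected triples contribute the empty set, so the
   union runs over all triples. *)
pose good (k : nat * nat * nat) := ball (e k.1.1 + e k.1.2) (2 * rad k.2) `<=` U.
pose V k : set T := [set x | good k] `&`
  (f @^-1` (ball (e k.1.1) (rad k.2)) `&` g @^-1` (ball (e k.1.2) (rad k.2))).
have -> : (fun x => f x + g x) @^-1` U = \bigcup_k V k.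
  apply/seteqP; split => [x /= Ux|x [k _] [/= gk [fx gx]]]; last first.
    apply: gk; move: fx gx; rewrite -!ball_normE/= => fx gx.
    rewrite opprD addrACA; apply: le_lt_trans (ler_normD _ _) _.
    by rewrite mulrDl mul1r ltrD.
  have /nbhs_ballP[r /= r0 rU] : nbhs (f x + g x) U by exact: open_nbhs_nbhs.
  (* Points of the selected ball are within [2 * rad n] of its centre, which is within [2 * rad n]
     of [f x + g x]. *)
  pose n := Num.truncn (4 / r).
  have nr : 4 * rad n < r.
    by rewrite ltr_pdivrMr ?ltr0n// mulrC -ltr_pdivrMr//; exact: truncnS_gt.
  have [i hi] := he (f x) _ (rad0 n); have [j hj] := he (g x) _ (rad0 n).
  exists ((i, j), n) => //; split => /=; last first.
    by split; rewrite -ball_normE/= distrC.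
  move=> y; rewrite -ball_normE/= => hy; apply: rU; rewrite -ball_normE/=.
  have -> : f x + g x - y = (f x - e i) + (g x - e j) + (e i + e j - y).
    by rewrite [X in _ = X + _]addrACA -opprD addrA subrK.
  apply: le_lt_trans nr; apply: le_trans (ler_normD _ _) _.
  have := ler_normD (f x - e i) (g x - e j); lra.
apply: countable_bigcupT_measurable => // k.
have oB c r : measurable (ball (c : H) r : set (borel H)).
  by apply: sub_sigma_algebra; exact: ball_open.
apply: measurableI; last first.
  by apply: measurableI; rewrite -[X in measurable X]setTI; [apply: mf|apply: mg].
have [gk|ngk] := pselect (good k).
  suff -> : [set _ : T | good k] = setT by exact: measurableT.
  by apply/seteqP; split.
suff -> : [set _ : T | good k] = set0 by exact: measurable0.
by apply/seteqP; split.
Qed.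

End borel_measurability.

(** * Independence of the past and the next observation *)

Section filtration_independence.
Context d d' (T : measurableType d) (T' : measurableType d') (R : realType).
Context (P : probability T R) (X : nat -> {RV P >-> T'}).
Notation XT := (fun n => X n : T -> T').

Lemma natural_filtration_measurable n : natural_filtration XT n `<=` measurable.
Proof.
apply: smallest_sub; first exact: sigma_algebra_measurable.
by move=> _ [i _] [B mB <-]; exact: measurable_funP.
Qed.

Lemma natural_filtration_le k n : (k <= n)%N ->
  natural_filtration XT k `<=` natural_filtration XT n.
Proof.
move=> kn; apply: sub_smallest2r; first exact: smallest_sigma_algebra.
apply: bigcup_subset => i /= /andP[-> ik]; exact: leq_trans ik kn.
Qed.

Lemma sigma_measurable_sample k n : (1 <= k <= n)%N ->
  sigma_measurable (natural_filtration XT n) (X k : T -> T').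
Proof.
move=> kn B mB; apply: sub_sigma_algebra; exists k => //; exists B => //.
by rewrite setTI.
Qed.

(** A pi-system on which the hypothesis of independence computes [P] directly; the generators of the
    filtration are not stable under intersection. *)
Definition cylinders n : set (set T) :=
  [set \bigcap_(i in [set i | (1 <= i <= n)%N]) (X i @^-1` A i)
    | A in [set A : nat -> set T' | forall i, measurable (A i)]].

Lemma natural_filtration_sub_cylinders n :
  natural_filtration XT n `<=` <<s cylinders n >>.
Proof.
apply: smallest_sub; first exact: smallest_sigma_algebra.
move=> _ [k /= kn] [B mB <-]; apply: sub_sigma_algebra.
exists (fun i => if i == k then B else setT) => /=.
  by move=> i; case: ifP => // _; exact: measurableT.
rewrite setTI; apply/seteqP; split => [w h|w Bw i _] /=.
  by have := h k kn; rewrite /= eqxx.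
by case: eqP => // ->.
Qed.

Lemma cylinders_setI n : setI_closed (cylinders n).
Proof.
move=> _ _ [A mA <-] [B mB <-]; exists (fun i => A i `&` B i).
  by move=> i; apply: measurableI; [exact: mA|exact: mB].
by rewrite -bigcapI; apply: eq_bigcapr => i _; rewrite preimage_setI.
Qed.

(** For fixed [A] both sides are finite measures in [B]; they agree on the cylinders, hence on the
    sigma-algebra these generate. *)
Lemma natural_filtration_independent n (B : set T) (A : set T') :
  independent_family P [set n | (1 <= n)%N] XT ->
  natural_filtration XT n B -> measurable A ->
  P (B `&` X n.+1 @^-1` A) = (P B * P (X n.+1 @^-1` A))%E.
Proof.
move=> indep FB mA.
have mXA : measurable (X n.+1 @^-1` A) by exact: measurable_funPTI.
have PA : (0 <= fine (P (X n.+1 @^-1` A))) by exact: fine_ge0.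
have PE : P (X n.+1 @^-1` A) = (fine (P (X n.+1 @^-1` A)))%:E.
  by rewrite fineK// fin_num_measure.
rewrite muleC PE.
pose J : {fset nat} := [fset i in iota 1 n]%fset.
have JE (i : nat) : (i \in J) = (1 <= i <= n)%N.
  by rewrite !inE/= mem_iota add1n ltnS.
have JS : [set` J] = [set i | (1 <= i <= n)%N].
  by apply/seteqP; split => i /=; rewrite JE.
have cylP C : (forall i, measurable (C i)) ->
    P (\bigcap_(i in [set i | (1 <= i <= n)%N]) (X i @^-1` C i)) =
    (\prod_(i <- J) P (X i @^-1` C i))%E.
  move=> mC; rewrite -indep//; last by move=> i /=; rewrite JE => /andP[].
  by rewrite JS.
apply: (g_sigma_algebra_measure_unique (cylinders n) _ (fun=> setT) _ _
  (mrestr P mXA) (mscale (NngNum PA) P)).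
- move=> _ [C mC <-].
  by apply: bigcap_measurableType => i _; exact: measurable_funPTI.
- move=> _; exists (fun=> setT) => //; apply/seteqP; split => //.
- by apply/seteqP; split => // x _; exists 0%N.
- exact: cylinders_setI.
- move=> _ [C mC <-]; set D := \bigcap_(i in _) _.
  change (P (D `&` X n.+1 @^-1` A) = ((fine (P (X n.+1 @^-1` A)))%:E * P D)%E).
  rewrite -PE /D cylP//.
  (* With [A] placed at index [n.+1], the intersection is itself a cylinder over one more index. *)
  pose C' i := if i == n.+1 then A else C i.
  have mC' i : measurable (C' i) by rewrite /C'; case: ifP => // _; exact: mC.
  have nJ : n.+1 \notin J by rewrite JE ltnn andbF.
  have J0 : [set` (n.+1 |` J)%fset] `<=` [set n | (1 <= n)%N].
    by move=> i /=; rewrite !inE => /predU1P[->//|]; rewrite mem_iota => /andP[].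
  have := indep (n.+1 |` J)%fset C' J0 mC'.
  have C'J i : i \in J -> C' i = C i.
    by rewrite /C' JE => /andP[_ iJ]; rewrite ltn_eqF// ltnS.
  rewrite big_fsetU1// [in X in _ = (X * _)%E]/C' eqxx.
  rewrite (eq_big_seq (fun i => P (X i @^-1` C i))); last by move=> i /C'J ->.
  move=> <-; congr (P _); rewrite /D -JS; apply/seteqP; split => [w [h hA] i|w h].
    rewrite /= in_fset1U => /predU1P[->|iJ]; first by rewrite /C' eqxx.
    by rewrite C'J//; exact: h.
  split=> [i iJ|].
    by rewrite -(C'J _ iJ); apply: h => /=; rewrite in_fset1U iJ orbT.
  by have := h n.+1; rewrite /C' eqxx; apply => /=; rewrite in_fset1U eqxx.
- move=> k; rewrite /mrestr; apply: le_lt_trans (ltry 1).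
  by apply: probability_le1; exact: measurableI.
- exact: natural_filtration_sub_cylinders.
Qed.

End filtration_independence.

Section independent_pair.
Context d d1 d2 (T : measurableType d) (T1 : measurableType d1)
  (T2 : measurableType d2) (R : realType) (P : probability T R).
Local Open Scope ereal_scope.

(** Independence identifies the joint law with the product law, and Tonelli integrates out [X]
    first. *)
Lemma independent_pair_integral (X : {mfun T >-> T1}) (Y : {mfun T >-> T2})
    (f : T1 * T2 -> \bar R) :
  (forall A B, measurable A -> measurable B ->
    P (X @^-1` A `&` Y @^-1` B) = P (X @^-1` A) * P (Y @^-1` B)) ->
  measurable_fun setT f -> (forall z, 0 <= f z) ->
  \int[P]_w f (X w, Y w) = \int[P]_w \int[distribution P X]_x f (x, Y w).
Proof.
move=> indep mf f0.
have mXY : measurable_fun setT (fun w => (X w, Y w)).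
  by apply: measurable_fun_pair; exact: measurable_funP.
pose XY : {mfun T >-> (T1 * T2)%type} :=
  HB.pack (fun w => (X w, Y w)) (isMeasurableFun.Build _ _ _ _ _ mXY).
have law A : measurable A ->
    (distribution P X \x distribution P Y) A = distribution P XY A.
  apply: product_measure_unique => B C mB mC.
  rewrite /= -indep//.
transitivity (\int[distribution P XY]_z f z).
  by rewrite ge0_integral_pushforward.
transitivity (\int[distribution P X \x distribution P Y]_z f z).
  by apply: eq_measure_integral => A mA _; apply/esym; exact: law.
rewrite fubini_tonelli2// ge0_integral_pushforward//.
  exact: measurable_fun_fubini_tonelli_G.
by move=> y _; apply: integral_ge0.
Qed.

End independent_pair.

(** * Moments of the stochastic gradient iterates *)

Section probability_integrals.
Context d (T : measurableType d) (R : realType) (P : probability T R).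

Lemma probability_integral_cst (a : R) : (\int[P]_w a%:E = a%:E)%E.
Proof.
rewrite -[RHS]mule1 -(@probability_setT _ _ _ P).
exact: (integral_cst P measurableT a%:E).
Qed.

(** The common shape of the upper bounds integrated below: a constant plus three integrable
    terms. *)
Lemma integral_affine (a b c k : R) (f g h : T -> R) :
  P.-integrable setT (EFin \o f) -> P.-integrable setT (EFin \o g) ->
  P.-integrable setT (EFin \o h) ->
  (\int[P]_w (a + b * f w + c * g w + k * h w)%:E =
   (a + b * fine (\int[P]_w (f w)%:E) + c * fine (\int[P]_w (g w)%:E)
      + k * fine (\int[P]_w (h w)%:E))%:E)%E.
Proof.
move=> fi gi hi.
have scal (x : R) (s : T -> R) : P.-integrable setT (EFin \o s) ->
    P.-integrable setT (fun w => x%:E * (s w)%:E)%E /\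
    (\int[P]_w (x%:E * (s w)%:E) = (x * fine (\int[P]_w (s w)%:E))%:E)%E.
  move=> si; split; first exact: integrableZl.
  by rewrite integralZl// EFinM fineK//; exact: integrable_fin_num.
have [bi bE] := scal b _ fi; have [ci cE] := scal c _ gi.
have [ki kE] := scal k _ hi.
have ai : P.-integrable setT (EFin \o cst a).
  exact: finite_measure_integrable_cst.
transitivity (\int[P]_w (a%:E + b%:E * (f w)%:E + c%:E * (g w)%:E + k%:E * (h w)%:E))%E.
  by apply: eq_integral => w _; rewrite !EFinD !EFinM.
rewrite integralD//; last by do 2 apply: integrableD => //.
rewrite integralD//; last exact: integrableD.
by rewrite integralD// probability_integral_cst bE cE kE -!EFinD.
Qed.

Lemma nonneg_integrable (f : T -> R) (A : R) : measurable_fun setT f ->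
  (forall w, 0 <= f w) -> (\int[P]_w (f w)%:E <= A%:E)%E ->
  P.-integrable setT (EFin \o f) /\ 0 <= fine (\int[P]_w (f w)%:E) <= A.
Proof.
move=> mf f0 fA.
have i0 : (0 <= \int[P]_w (f w)%:E)%E.
  by apply: integral_ge0 => w _; rewrite lee_fin.
have fin : (\int[P]_w (f w)%:E)%E \is a fin_num.
  by rewrite ge0_fin_numE// (le_lt_trans fA)// ltry.
split; last by rewrite fine_ge0//= -lee_fin fineK.
apply/integrableP; split; first exact/measurable_EFinP.
under eq_integral do rewrite /= ger0_norm//.
by rewrite (le_lt_trans fA)// ltry.
Qed.

End probability_integrals.

(** * Expected effect of one step from a fixed point *)

Section gradient_step.
Context {R : realType} {H : completeNormedModType R} {dot : {dot H for idfun}}.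
Hypothesis Hnorm : norm_from_dot dot.

Lemma continuous_dotr (u : H) : continuous (fun h => dot h u).
Proof.
have -> : (fun h => dot h u) = (fun h => (`|u + h| ^+ 2 - `|u| ^+ 2 - `|h| ^+ 2) / 2).
  by apply/funext => h; rewrite (sqr_normD Hnorm); field.
move=> x; apply: cvgM; last exact: cvg_cst.
have c1 : `|u + y| @[y --> x] --> `|u + x|.
  by apply: cvg_norm; apply: cvgD; [exact: cvg_cst|exact: cvg_id].
have c3 : `|y| @[y --> x] --> `|x| by apply: cvg_norm; exact: cvg_id.
by apply: cvgB; [apply: cvgB; [exact: cvgM|exact: cvg_cst]|exact: cvgM].
Qed.

(** One form for the powers of [|h|], [|h - m|] and [|u - g *: h|]. *)
Lemma continuous_norm_affine_pow (u : H) (a : R) (k : nat) :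
  continuous (fun h : H => `|u + a *: h| ^+ k).
Proof.
move=> x.
have c1 : `|u + a *: y| @[y --> x] --> `|u + a *: x|.
  apply: cvg_norm; apply: cvgD; [exact: cvg_cst|].
  by apply: cvgZ; [exact: cvg_cst|exact: cvg_id].
exact: (continuous_comp c1 (@exprn_continuous R k _)).
Qed.

(** [norm_sub_pow_le] is integrated in [Y], and the linear term becomes [dot v u] by the weak
    definition of expectation. [C] is chosen before [u] and [Y], hence uniform over the positions of
    the iterate. *)
Lemma expected_step_le p : exists2 C : R, 0 < C &
  forall d (T : measurableType d) (P : probability T R) (Y : T -> H) (v u : H)
    (g A1 A2 : R),
  0 <= g -> is_expectation dot P Y v ->
  (\int[P]_w (`|Y w| ^+ 2)%:E <= A1%:E)%E ->
  (\int[P]_w (`|Y w| ^+ (2 * p.+1))%:E <= A2%:E)%E ->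
  (\int[P]_w (`|u - g *: Y w| ^+ (2 * p.+1))%:E <=
    (`|u| ^+ (2 * p.+1) - 2 * p.+1%:R * `|u| ^+ (2 * p) * g * dot v u
       + C * (`|u| ^+ (2 * p) * g ^+ 2 * A1 + g ^+ (2 * p.+1) * A2))%:E)%E.
Proof.
have [C C0 hC] := norm_sub_pow_le Hnorm p.
exists C => // d T P Y v u g A1 A2 g0 [mY iY EY] i1 i2.
have mpow k : measurable_fun setT (fun w => `|Y w| ^+ k).
  apply: (measurableT_comp (f := fun h : borel H => `|h| ^+ k)) => //.
  apply: measurable_continuous_real.
  have -> : (fun h : H => `|h| ^+ k) = (fun h : H => `|0 + 1 *: h| ^+ k).
    by apply/funext => h; rewrite add0r scale1r.
  exact: continuous_norm_affine_pow.
have [n1 /andP[_ f1]] := nonneg_integrable (mpow 2%N) (fun=> sqr_ge0 _) i1.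
have [n2 /andP[_ f2]] := nonneg_integrable (mpow _) (fun w => exprn_ge0 _ (normr_ge0 _)) i2.
have md : measurable_fun setT (fun w => dot (Y w) u).
  apply: (measurableT_comp (f := fun h : borel H => dot h u)) => //.
  by apply: measurable_continuous_real; exact: continuous_dotr.
have nd : P.-integrable setT (EFin \o (fun w => dot (Y w) u)).
  have iYu : P.-integrable setT (fun w => `|u|%:E * `|Y w|%:E)%E by exact: integrableZl.
  apply: le_integrable iYu => //; first exact/measurable_EFinP.
  move=> w _. rewrite /= lee_fin normrM !normr_id mulrC.
  exact: normr_dot_le.
have ED : fine (\int[P]_w (dot (Y w) u)%:E) = dot v u.
  by have := EY u; rewrite unlock => ->.
have C0' := ltW C0.
pose F w := `|u| ^+ (2 * p.+1) + (- (2 * p.+1%:R * `|u| ^+ (2 * p) * g)) * dot (Y w) u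
  + C * (`|u| ^+ (2 * p) * g ^+ 2) * `|Y w| ^+ 2
  + C * g ^+ (2 * p.+1) * `|Y w| ^+ (2 * p.+1).
have leF w : `|u - g *: Y w| ^+ (2 * p.+1) <= F w.
  apply: (le_trans (hC u (g *: Y w))).
  by rewrite dotZl normrZ (ger0_norm g0) !exprMn /F; lra.
have mF : measurable_fun setT F.
  do 3 (apply: measurable_funD => //; last exact: measurable_funM).
apply: (@le_trans _ _ (\int[P]_w (F w)%:E)%E).
  apply: ge0_le_integral => //.
  - apply/measurable_EFinP.
    apply: (measurableT_comp (f := fun h : borel H => `|u - g *: h| ^+ (2 * p.+1))) => //.
    apply: measurable_continuous_real.
    under eq_fun do rewrite -scaleNr.
    exact: continuous_norm_affine_pow.
  - exact/measurable_EFinP.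
  - by move=> w _; rewrite lee_fin.
rewrite integral_affine// ED lee_fin.
have e1 : C * (`|u| ^+ (2 * p) * g ^+ 2) * fine (\int[P]_w (`|Y w| ^+ 2)%:E) <=
    C * (`|u| ^+ (2 * p) * g ^+ 2) * A1.
  by apply: ler_wpM2l => //; rewrite !mulr_ge0 ?exprn_ge0.
have e2 : C * g ^+ (2 * p.+1) * fine (\int[P]_w (`|Y w| ^+ (2 * p.+1))%:E) <=
    C * g ^+ (2 * p.+1) * A2.
  by apply: ler_wpM2l => //; rewrite !mulr_ge0 ?exprn_ge0.
lra.
Qed.

End gradient_step.

Lemma exprD_le_pow2 (R : realType) (a b : R) (k : nat) : 0 <= a -> 0 <= b ->
  (a + b) ^+ k <= 2 ^+ k * (a ^+ k + b ^+ k).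
Proof.
move=> a0 b0; wlog ab : a b a0 b0 / a <= b.
  move=> h; have [ab|/ltW ba] := leP a b; first exact: h.
  by rewrite addrC [_ ^+ _ + _]addrC; exact: h.
apply: (@le_trans _ _ ((2 * b) ^+ k)).
  by apply: lerXn2r; rewrite ?nnegrE; lra.
by rewrite exprMn ler_wpM2l ?exprn_ge0// lerDr exprn_ge0.
Qed.

Section gradient_moments.
Context {R : realType} {H : completeNormedModType R}.
Context d (T : measurableType d) (P : probability T R).
Context dX (XX : measurableType dX) (X : {RV P >-> XX}).
Variables (gradg : XX -> H -> H) (m : H).
Hypothesis gradg_meas : measurable_fun [set: XX * borel H]
  ((fun z => gradg z.1 z.2) : XX * borel H -> borel H).

Lemma measurable_gradient_sample h k :
  measurable_fun setT (fun w => `|gradg (X w) h| ^+ k).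
Proof.
have mY : measurable_fun setT ((fun w => gradg (X w) h) : T -> borel H).
  apply: (measurableT_comp gradg_meas (g := fun w => (X w, h : borel H))).
  by apply: measurable_fun_pair => //; exact: measurable_funP.
apply: (measurableT_comp (f := fun h : borel H => `|h| ^+ k) _ mY).
apply: measurable_continuous_real.
have -> : (fun h : H => `|h| ^+ k) = (fun h : H => `|0 + 1 *: h| ^+ k).
  by apply/funext => x; rewrite add0r scale1r.
exact: continuous_norm_affine_pow.
Qed.

(** Reduces (v.a) to (v.b), by taking powers of the envelope with [exprD_le_pow2]. *)
Lemma envelope_moments (f : XX -> H -> R) (C : R) :
  measurable_fun [set: XX * borel H] ((fun z => f z.1 z.2) : XX * borel H -> R) ->
  (forall x h, 0 <= f x h) -> 0 < C ->
  {ae distribution P X, forall x, forall h, `|gradg x h| <= f x h + C * `|h - m|} ->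
  (forall q, (1 <= q)%N -> exists2 L : R, 0 < L &
     forall h, ('E_P[fun w => (f (X w) h ^+ (2 * q))%R] <= L%:E)%E) ->
  forall q, (1 <= q)%N -> exists2 L : R, 0 < L &
    forall h, ('E_P[fun w => (`|gradg (X w) h| ^+ (2 * q))%R]
             <= (L * (1 + `|h - m| ^+ (2 * q)))%:E)%E.
Proof.
move=> mf f0 C0 [N [mN N0 Nsub]] fmom q q1.
have [L L0 hL] := fmom q q1; pose k := (2 * q)%N.
exists (2 ^+ k * (L + C ^+ k)) => [|h].
  by rewrite mulr_gt0 ?exprn_gt0// addr_gt0 ?exprn_gt0.
have r0 : 0 <= C * `|h - m| by rewrite mulr_ge0// ltW.
have mfh : measurable_fun setT (fun w => f (X w) h ^+ k).
  apply: measurable_funX.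
  apply: (measurableT_comp mf (g := fun w => (X w, h : borel H))).
  by apply: measurable_fun_pair => //; exact: measurable_funP.
have := hL h; rewrite unlock => hLh.
have [fi /andP[_ fL]] := nonneg_integrable mfh (fun w => exprn_ge0 _ (f0 _ _)) hLh.
(* The null terms give [F] the shape required by [integral_affine]. *)
pose F w := 2 ^+ k * (C * `|h - m|) ^+ k + 2 ^+ k * f (X w) h ^+ k
  + 0 * f (X w) h ^+ k + 0 * f (X w) h ^+ k.
apply: (@le_trans _ _ (\int[P]_w (F w)%:E)%E).
  apply: ae_ge0_le_integral => //.
  - exact/measurable_EFinP/measurable_gradient_sample.
  - move=> w _; rewrite lee_fin /F !mul0r !addr0.
    by rewrite addr_ge0 ?mulr_ge0 ?exprn_ge0.
  - apply/measurable_EFinP.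
    by do 3 (apply: measurable_funD => //; last exact: measurable_funM).
  - exists (X @^-1` N); split => //; first exact: measurable_funPTI.
    move=> w /= nw; apply: Nsub => /= good; apply: nw => _.
    rewrite lee_fin /F !mul0r !addr0 -mulrDr addrC.
    apply: le_trans (exprD_le_pow2 k (f0 (X w) h) r0).
    by apply: lerXn2r; rewrite ?nnegrE ?addr_ge0.
rewrite integral_affine// lee_fin !mul0r !addr0 exprMn.
rewrite -/k; set I := fine _ in fL *; set r := `|h - m|.
have rk : 0 <= r ^+ k by rewrite exprn_ge0// normr_ge0.
have Ck : 0 <= C ^+ k by rewrite exprn_ge0// ltW.
rewrite -mulrDr -mulrA; apply: ler_wpM2l; first exact: exprn_ge0.
have := mulr_ge0 (ltW L0) rk; lra.
Qed.

End gradient_moments.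

(** * The iterates: adaptedness, integrability and the moment inequality *)

Section stochastic_gradient.
Context {R : realType} {H : completeNormedModType R} {dot : {dot H for idfun}}.
Hypothesis Hnorm : norm_from_dot dot.
Hypothesis Hsep : separable_space H.
Context d (T : measurableType d) (P : probability T R).
Context dX (XX : measurableType dX) (X : {RV P >-> XX}).
Variables (gradg : XX -> H -> H) (gradG : H -> H) (m : H).
Hypothesis gradg_meas : measurable_fun [set: XX * borel H]
  ((fun z => gradg z.1 z.2) : XX * borel H -> borel H).
Hypothesis gradG_E : forall h,
  is_expectation dot P (fun w => gradg (X w) h) (gradG h).
Variables (Xs : nat -> {RV P >-> XX}) (Z : nat -> T -> H) (gamma : nat -> R).
Notation XT := (fun n => Xs n : T -> XX).
Hypothesis Xs_law : forall n, (1 <= n)%N -> same_law (Xs n) X.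
Hypothesis Xs_indep : independent_family P [set n | (1 <= n)%N] XT.
Hypothesis Z1_meas : sigma_measurable (natural_filtration XT 1) (Z 1%N : T -> borel H).
Hypothesis Z_rec : forall n, (1 <= n)%N -> forall w,
  Z n.+1 w = Z n w - gamma n *: gradg (Xs n.+1 w) (Z n w).

(** The domain is left free: it will be [T] with a sigma-algebra of the filtration, and the product
    [XX * H]. *)
Lemma measurable_gradient_step d' (T' : measurableType d') (x : T' -> XX) (z : T' -> H) (a : R) :
  measurable_fun setT x -> measurable_fun setT (z : T' -> borel H) ->
  measurable_fun setT ((fun w => z w + a *: gradg (x w) (z w)) : T' -> borel H).
Proof.
move=> mx mz; apply: measurable_addB => //.
apply: (measurableT_comp (f := (fun h : borel H => (a *: h) : borel H))).
  apply: (measurable_continuous_borel (f := fun h : H => a *: h)) => y.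
  by apply: cvgZ; [exact: cvg_cst|exact: cvg_id].
exact: (measurableT_comp gradg_meas (measurable_fun_pair mx mz)).
Qed.

Lemma iterate_adapted n : (1 <= n)%N ->
  sigma_measurable (natural_filtration XT n) (Z n : T -> borel H).
Proof.
elim: n => [//|[_ _|n IH _]]; first exact: Z1_meas.
set U := \bigcup_(i in [set i | (1 <= i <= n.+2)%N])
  preimage_set_system [set: T] (XT i) measurable.
(* Retyping [T] with the sigma-algebra generated by [U] turns adaptedness into plain
   measurability. *)
have mX : measurable_fun setT (Xs n.+2 : g_sigma_algebraType U -> XX).
  by move=> _ A mA; rewrite setTI; apply: sigma_measurable_sample; rewrite ?leqnn.
have mZ : measurable_fun setT (Z n.+1 : g_sigma_algebraType U -> borel H).
  move=> _ A mA; rewrite setTI.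
  exact: (natural_filtration_le (leqnSn _) (IH isT _ mA)).
have ZE : Z n.+2 = fun w => Z n.+1 w + (- gamma n.+1) *: gradg (Xs n.+2 w) (Z n.+1 w).
  by apply/funext => w; rewrite Z_rec// scaleNr.
move=> A mA; rewrite ZE.
have := measurable_gradient_step (- gamma n.+1) mX mZ measurableT mA.
by rewrite setTI.
Qed.

Lemma measurable_iterate n : (1 <= n)%N ->
  measurable_fun setT (Z n : T -> borel H).
Proof.
move=> n1 _ A mA; rewrite setTI; apply: (@natural_filtration_measurable _ _ _ _ _ _ Xs n).
exact: iterate_adapted.
Qed.

Lemma measurable_iterate_pow n k : (1 <= n)%N ->
  measurable_fun setT (fun w => `|Z n w - m| ^+ k).
Proof.
move=> n1; apply: (measurableT_comp (f := fun h : borel H => `|h - m| ^+ k)).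
  apply: measurable_continuous_real.
  have -> : (fun h : H => `|h - m| ^+ k) = (fun h : H => `|- m + 1 *: h| ^+ k).
    by apply/funext => x; rewrite scale1r addrC.
  exact: continuous_norm_affine_pow.
exact: measurable_iterate.
Qed.

(** This plays the role of conditioning on the past: [Z n] depends only on the first [n]
    observations, so the next one may be replaced by an independent copy [X w'] and integrated with
    [Z n w] frozen. *)
Lemma iterate_moment_succ n k (F : T -> R) : (1 <= n)%N ->
  measurable_fun setT F ->
  (forall w, (\int[P]_w' (`|(Z n w - m) - gamma n *: gradg (X w') (Z n w)| ^+ k)%:E
     <= (F w)%:E)%E) ->
  (\int[P]_w (`|Z n.+1 w - m| ^+ k)%:E <= \int[P]_w (F w)%:E)%E.
Proof.
move=> n1 mF hF.
pose phi (z : XX * borel H) : \bar R :=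
  (`|((z.2 : H) - gamma n *: gradg z.1 z.2) - m| ^+ k)%:E.
have mphi : measurable_fun setT phi.
  apply/measurable_EFinP.
  apply: (measurableT_comp (f := fun h : borel H => `|h - m| ^+ k)).
    apply: measurable_continuous_real.
    have -> : (fun h : H => `|h - m| ^+ k) = (fun h : H => `|- m + 1 *: h| ^+ k).
      by apply/funext => x; rewrite scale1r addrC.
    exact: continuous_norm_affine_pow.
  have := measurable_gradient_step (- gamma n) measurable_fst measurable_snd.
  by under eq_fun do rewrite scaleNr.
pose Zn : {mfun T >-> borel H} :=
  HB.pack (Z n : T -> borel H) (isMeasurableFun.Build _ _ _ _ _ (measurable_iterate n1)).
have -> : (\int[P]_w (`|Z n.+1 w - m| ^+ k)%:E = \int[P]_w phi (Xs n.+1 w, Zn w))%E.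
  by apply: eq_integral => w _; rewrite Z_rec.
have phi0 z : (0 <= phi z)%E by rewrite lee_fin exprn_ge0.
rewrite independent_pair_integral//; last first.
  move=> A B mA mB; rewrite setIC muleC natural_filtration_independent//.
  exact: iterate_adapted.
have inner w : (\int[distribution P (Xs n.+1)]_x phi (x, Zn w) =
    \int[P]_w' (`|(Z n w - m) - gamma n *: gradg (X w') (Z n w)| ^+ k)%:E)%E.
  transitivity (\int[distribution P X]_x phi (x, Zn w))%E.
    by apply: eq_measure_integral => A mA _; exact: Xs_law.
  rewrite ge0_integral_pushforward//; last exact: (measurable_fun_pair1 _ mphi).
  by apply: eq_integral => w' _; rewrite /phi/= addrAC.
apply: ge0_le_integral => //.
- by move=> w _; apply: integral_ge0.
- apply: (measurableT_comp (f := fun y => \int[distribution P (Xs n.+1)]_x phi (x, y))%E).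
    exact: measurable_fun_fubini_tonelli_G.
  exact: measurable_iterate.
- exact/measurable_EFinP.
- by move=> w _; rewrite inner.
Qed.

Hypothesis Z1_bounded : exists M : R, forall w : T, `|Z 1%N w| <= M.
Variable gmax : R.
Hypothesis gamma_range : forall n, (1 <= n)%N -> 0 <= gamma n <= gmax.
Variable c : R.
Hypothesis c0 : 0 < c.
Hypothesis drift : forall h,
  c * Num.min `|h - m| (`|h - m| ^+ 2) <= dot (gradG h) (h - m).
Hypothesis grad_moments : forall q, (1 <= q)%N -> exists2 L : R, 0 < L &
  forall h, ('E_P[fun w => (`|gradg (X w) h| ^+ (2 * q))%R]
           <= (L * (1 + `|h - m| ^+ (2 * q)))%:E)%E.

Notation moment p n := (fine (\int[P]_w (`|Z n w - m| ^+ (2 * p))%:E)).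

(** Integrability at time [n] is assumed because [fine] would read an infinite moment as 0. The left
    side stays extended-real, since this bound is also what proves integrability at time [n.+1]. *)
Lemma moment_step p : exists C kappa : R, [/\ 0 < C, 0 < kappa &
  forall (B : R) (q n : nat), 0 <= B <= 1 -> (1 <= n)%N ->
   (forall k, P.-integrable setT (EFin \o (fun w => `|Z n w - m| ^+ (2 * k)))) ->
   (\int[P]_w (`|Z n.+1 w - m| ^+ (2 * p.+1))%:E <=
     ((1 + C * gamma n ^+ 2 - kappa * gamma n * B) * moment p.+1 n
      + kappa * gamma n * B ^+ (2 * q).+1 * moment (p.+1 + q) n
      + C * gamma n ^+ 2 * moment p n + C * gamma n ^+ (2 * p.+1))%:E)%E].
Proof.
have [C C0 hC] := expected_step_le Hnorm p.
have [L1 L10 hL1] := grad_moments (isT : (1 <= 1)%N).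
have [L2 L20 hL2] := grad_moments (isT : (1 <= p.+1)%N).
have gmax0 : 0 <= gmax by have /andP[/le_trans] := gamma_range (isT : (1 <= 1)%N); apply.
have G0 : 0 <= gmax ^+ (2 * p) by rewrite exprn_ge0.
have CL1 : 0 < C * L1 by rewrite mulr_gt0.
have CL2 : 0 < C * L2 by rewrite mulr_gt0.
have CL2G : 0 <= C * L2 * gmax ^+ (2 * p) by rewrite mulr_ge0// ltW.
(* The last term absorbs [gamma ^ (2 p + 2) * r ^ (2 p + 2)] into the [gamma ^ 2] growth of the
   leading moment. *)
pose D := C * L1 + C * L2 + C * L2 * gmax ^+ (2 * p).
pose kappa := 2 * p.+1%:R * c.
have k0 : 0 < kappa by rewrite /kappa !mulr_gt0.
exists D, kappa; split => //; first by rewrite /D; lra.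
move=> B q n B01 n1 int_n; have [B0 B1] := andP B01.
have [g0 gM] := andP (gamma_range n1).
set g := gamma n in g0 gM *.
pose F w := D * g ^+ (2 * p.+1)
  + (1 + D * g ^+ 2 - kappa * g * B) * `|Z n w - m| ^+ (2 * p.+1)
  + (kappa * g * B ^+ (2 * q).+1) * `|Z n w - m| ^+ (2 * (p.+1 + q))
  + D * g ^+ 2 * `|Z n w - m| ^+ (2 * p).
apply: (@le_trans _ _ (\int[P]_w (F w)%:E)%E); last first.
  by rewrite /F integral_affine// lee_fin; lra.
apply: iterate_moment_succ => //.
  by do 3 (apply: measurable_funD => //; last by
    (apply: measurable_funM => //; exact: measurable_iterate_pow)).
move=> w; set h := Z n w.
have := hL1 h; rewrite muln1 unlock => hl1.
have := hL2 h; rewrite unlock => hl2.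
apply: (le_trans (hC _ _ P _ _ (h - m) _ _ _ g0 (gradG_E h) hl1 hl2)).
rewrite lee_fin /F -/h.
have := drift h; have := min_drift_ge q B01 (normr_ge0 (h - m)).
set r := `|h - m|; set t := dot _ _ => hmin hdr.
have r0 : 0 <= r by exact: normr_ge0.
have rp0 : 0 <= r ^+ (2 * p) by rewrite exprn_ge0.
have rE : r ^+ (2 * p.+1) = r ^+ (2 * p) * r ^+ 2 by rewrite mulnS exprD mulrC.
have rqE : r ^+ (2 * (p.+1 + q)) = r ^+ (2 * p) * r ^+ (2 * q.+1).
  by rewrite -exprD -mulnDr addSnnS.
have gE : g ^+ (2 * p.+1) = g ^+ 2 * g ^+ (2 * p) by rewrite mulnS exprD.
have gG : g ^+ (2 * p) <= gmax ^+ (2 * p) by apply: lerXn2r.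
have g20 : 0 <= g ^+ 2 by exact: sqr_ge0.
have gp0 : 0 <= g ^+ (2 * p.+1) by rewrite exprn_ge0.
have rp1 : 0 <= r ^+ (2 * p.+1) by rewrite exprn_ge0.
have dr : kappa * g * r ^+ (2 * p) * (B * r ^+ 2 - B ^+ (2 * q).+1 * r ^+ (2 * q.+1))
    <= 2 * p.+1%:R * r ^+ (2 * p) * g * t.
  have -> : kappa * g * r ^+ (2 * p) * (B * r ^+ 2 - B ^+ (2 * q).+1 * r ^+ (2 * q.+1)) =
    2 * p.+1%:R * r ^+ (2 * p) * g *
      (c * (B * r ^+ 2 - B ^+ (2 * q).+1 * r ^+ (2 * q.+1))) by rewrite /kappa; ring.
  apply: ler_wpM2l; first by rewrite !mulr_ge0.
  by apply: le_trans hdr; rewrite ler_pM2l.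
have e1 : C * L2 * g ^+ (2 * p.+1) * r ^+ (2 * p.+1) <=
    C * L2 * gmax ^+ (2 * p) * g ^+ 2 * r ^+ (2 * p.+1).
  apply: ler_wpM2r => //; rewrite gE.
  have := ler_wpM2l (mulr_ge0 (ltW CL2) g20) gG; lra.
rewrite rqE /D; rewrite rE in e1 rp1 *.
have a1 : 0 <= C * L1 * g ^+ (2 * p.+1) by rewrite mulr_ge0// ltW.
have a2 : 0 <= C * L2 * gmax ^+ (2 * p) * g ^+ (2 * p.+1) by rewrite mulr_ge0.
have b1 : 0 <= C * L2 * g ^+ 2 * (r ^+ (2 * p) * r ^+ 2) by rewrite !mulr_ge0// ltW.
have d1 : 0 <= C * L2 * g ^+ 2 * r ^+ (2 * p) by rewrite !mulr_ge0// ltW.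
have d2 : 0 <= C * L2 * gmax ^+ (2 * p) * g ^+ 2 * r ^+ (2 * p) by rewrite !mulr_ge0// ltW.
lra.
Qed.

(** Induction on [n] for all orders at once, started by the boundedness of [Z 1] and continued by
    [moment_step] with [B = 0], which speaks of positive orders only; order 0 is the constant 1. *)
Lemma moment_integrable n : (1 <= n)%N -> forall k,
  P.-integrable setT (EFin \o (fun w => `|Z n w - m| ^+ (2 * k))).
Proof.
elim: n => [//|[_ _ k|n IH _ k]].
  have [M hM] := Z1_bounded.
  apply: (proj1 (nonneg_integrable (A := (M + `|m|) ^+ (2 * k)) _ _ _)).
  - exact: measurable_iterate_pow.
  - by move=> w; rewrite exprn_ge0.
  rewrite -(probability_integral_cst P).
  apply: ge0_le_integral => //.
  - by apply/measurable_EFinP; exact: measurable_iterate_pow.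
  - move=> w _; rewrite lee_fin; apply: lerXn2r; rewrite ?nnegrE//.
      by rewrite addr_ge0// (le_trans _ (hM w)).
    by apply: le_trans (ler_normB _ _) _; rewrite lerD2r.
case: k => [|p].
  apply: (proj1 (nonneg_integrable (A := 1) _ _ _)).
  - exact: measurable_iterate_pow.
  - by move=> w; rewrite exprn_ge0.
  under eq_integral do rewrite muln0 expr0.
  by rewrite probability_integral_cst.
have [C [kappa [_ _ hstep]]] := moment_step p.
have b01 : 0 <= (0 : R) <= 1 by rewrite lexx ler01.
apply: (proj1 (nonneg_integrable _ _ (hstep 0 0%N n.+1 b01 isT (IH isT)))).
- exact: measurable_iterate_pow.
- by move=> w; rewrite exprn_ge0.
Qed.

Lemma stochastic_gradient_moment_rate (cg alpha : R) : 0 < cg -> 2^-1 < alpha < 1 ->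
  (forall n, (1 <= n)%N -> gamma n = cg * n%:R `^ (- alpha)) ->
  forall p, exists2 K : R, 0 < K & forall n, (1 <= n)%N ->
    ('E_P[fun w => (`|Z n w - m| ^+ (2 * p))%R] <= (K * n%:R `^ (- (p%:R * alpha)))%:E)%E.
Proof.
move=> cg0 al gE p.
have E p' n : (1 <= n)%N ->
    (\int[P]_w (`|Z n w - m| ^+ (2 * p'))%:E)%E = (moment p' n)%:E.
  by move=> n1; rewrite fineK//; apply: integrable_fin_num => //; exact: moment_integrable.
have [| | |K K0 hK] := @moment_rate R (fun k n => moment k n) gamma cg alpha cg0 al gE _ _ _ p.
- by move=> k n; apply: fine_ge0; apply: integral_ge0 => w _; rewrite lee_fin exprn_ge0.
- move=> n n1; rewrite -lee_fin -E//.
  under eq_integral do rewrite muln0 expr0.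
  by rewrite probability_integral_cst.
- move=> k; have [C [kappa [C0 k0 hstep]]] := moment_step k.
  exists C, kappa; split => // B q n B01 n1.
  rewrite -lee_fin -E//; apply: hstep => //.
  exact: moment_integrable.
exists K => // n n1.
by rewrite unlock E// lee_fin; exact: hK.
Qed.

End stochastic_gradient.

Theorem theorem4p3
  (R : realType)
  (* the separable real Hilbert space H *)
  (H : completeNormedModType R) (dot : {dot H for idfun})
  (Hnorm : norm_from_dot dot) (Hsep : separable_space H)
  (* probability space, sample space, generic random variable X *)
  (dT : measure_display) (T : measurableType dT) (P : probability T R)
  (dX : measure_display) (XX : measurableType dX) (X : {RV P >-> XX})
  (* g, its gradient in h, and G(h) = E[g(X,h)] *)
  (g : XX -> H -> R) (gradg : XX -> H -> H)
  (G : H -> R) (gradG : H -> H) (Gamma : H -> H -> H) (m : H)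
  (G_int : forall h : H, P.-integrable [set: T] (fun w => (g (X w) h)%:E))
  (G_def : forall h : H, ('E_P[fun w => g (X w) h] = (G h)%:E)%E)
  (G_convex : convex_function [set: H] G)
  (gradg_meas : measurable_fun [set: XX * borel H]
     ((fun z => gradg z.1 z.2) : XX * borel H -> borel H))
  (gradg_def : forall (x : XX) (h : H),
     differentiable (g x : H -> R^o) h -> is_gradient dot (g x) h (gradg x h))
  (gradG_E : forall h : H,
     is_expectation dot P (fun w => gradg (X w) h) (gradG h))
  (* the sample X_1, X_2, ... and the algorithm Z_1, Z_2, ... *)
  (Xs : nat -> {RV P >-> XX}) (Z : nat -> T -> H)
  (c_gamma alpha : R) (gamma : nat -> R)
  (Xs_law : forall n : nat, (1 <= n)%N -> same_law (Xs n) X)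
  (Xs_indep : independent_family P [set n | (1 <= n)%N] (fun n => Xs n : T -> XX))
  (Z1_meas : sigma_measurable
     (natural_filtration (fun n => Xs n : T -> XX) 1) (Z 1%N : T -> borel H))
  (Z1_bounded : exists M : R, forall w : T, `|Z 1%N w| <= M)
  (Z_rec : forall n : nat, (1 <= n)%N -> forall w : T,
     Z n.+1 w = Z n w - gamma n *: gradg (Xs n.+1 w) (Z n w))
  (c_gamma_gt0 : 0 < c_gamma) (alpha_range : 2^-1 < alpha < 1)
  (gamma_def : forall n : nat, (1 <= n)%N ->
     gamma n = c_gamma * n%:R `^ (- alpha))
  (* (i) *)
  (hi_g : forall h : H,
     {ae distribution P X, forall x, differentiable (g x : H -> R^o) h})
  (hi_G : forall h : H, is_gradient dot G h (gradG h))
  (hi_m : gradG m = 0)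
  (* (ii) *)
  (hii_hess : forall h : H, is_hessian dot gradG h (Gamma h))
  (hii_cont : forall h : H,
     op_norm (fun u => Gamma k u - Gamma h u) @[k --> h] --> (0%E : \bar R))
  (hii_bound : forall A : R, 0 < A -> exists2 CA : R, 0 < CA &
     forall h : H, `|h - m| <= A -> (op_norm (Gamma h) <= CA%:E)%E)
  (* (iii) *)
  (hiii :
     (exists2 eps : R, 0 < eps &
        [/\ forall h : H, `|h - m| <= eps -> has_eigenbasis dot (Gamma h),
            (0 < inf_eigenvalues (Gamma m))%E
          & forall h : H, `|h - m| <= eps ->
            forall l : R, is_eigenvalue (Gamma h) l ->
            (inf_eigenvalues (Gamma m) * (2^-1)%:E <= l%:E)%E])
     \/
     [/\ has_eigenbasis dot (Gamma m),
         (0 < inf_eigenvalues (Gamma m))%E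
       & exists c c' : R, [/\ 0 < c, 0 < c' &
           forall A : R, 0 < A -> forall h : H, `|h - m| <= A ->
             Num.min c (c' / A) * `|h - m| ^+ 2 <= dot (gradG h) (h - m)]])
  (* (iv) *)
  (hiv : exists eps' Ceps' : R, [/\ 0 < eps', 0 < Ceps' &
     forall h : H, `|h - m| <= eps' ->
       `|gradG h - Gamma m (h - m)| <= Ceps' * `|h - m| ^+ 2])
  (* (v) *)
  (hv :
     (exists (f : XX -> H -> R) (C : R),
        [/\ measurable_fun [set: XX * borel H]
              ((fun z => f z.1 z.2) : XX * borel H -> R),
            forall (x : XX) (h : H), 0 <= f x h,
            0 < C,
            {ae distribution P X, forall x, forall h : H,
               `|gradg x h| <= f x h + C * `|h - m|}
          & forall q : nat, (1 <= q)%N -> exists2 L : R, 0 < L &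
              forall h : H, ('E_P[fun w => (f (X w) h ^+ (2 * q))%R] <= L%:E)%E])
     \/
     (forall q : nat, (1 <= q)%N -> exists2 L : R, 0 < L &
        forall h : H,
          ('E_P[fun w => (`|gradg (X w) h| ^+ (2 * q))%R]
             <= (L * (1 + `|h - m| ^+ (2 * q)))%:E)%E)) :
  forall p : nat, (1 <= p)%N -> exists2 K : R, 0 < K &
    forall n : nat, (1 <= n)%N ->
      ('E_P[fun w => (`|Z n w - m| ^+ (2 * p))%R]
         <= (K / n%:R `^ (p%:R * alpha))%:E)%E.
Proof.
(* Both alternatives of (iii) give these spectral data at [m]; in the first, [m] lies in its own
   ball. *)
have [eigb eig0] : has_eigenbasis dot (Gamma m) /\ (0 < inf_eigenvalues (Gamma m))%E.
  case: hiii => [[e e0 [eb ev _]]|[eb ev _]]; split => //.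
  by apply: eb; rewrite subrr normr0 ltW.
have [e [C [e0 C0 taylor]]] := hiv.
have [c c0 drift] := global_drift Hnorm G_convex hi_G (hii_hess m) eigb eig0 e0 C0 taylor.
have gamma_range n : (1 <= n)%N -> 0 <= gamma n <= c_gamma.
  move=> n1; rewrite gamma_def//; have cg0 := ltW c_gamma_gt0.
  rewrite mulr_ge0 ?powR_ge0//= ler_piMr// -[leRHS](powRr0 n%:R).
  by apply: ler_powR; [rewrite ler1n|case/andP: alpha_range; lra].
have moments : forall q, (1 <= q)%N -> exists2 L : R, 0 < L & forall h,
    ('E_P[fun w => (`|gradg (X w) h| ^+ (2 * q))%R]
       <= (L * (1 + `|h - m| ^+ (2 * q)))%:E)%E.
  by case: hv => [[f [D [mf f0 D0 env fmom]]]|//]; exact: envelope_moments env fmom.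
move=> p _.
have [K K0 hK] := stochastic_gradient_moment_rate Hnorm Hsep gradg_meas gradG_E
  Xs_law Xs_indep Z1_meas Z_rec Z1_bounded gamma_range c0 drift moments
  c_gamma_gt0 alpha_range gamma_def p.
by exists K => // n n1; rewrite -powRN; exact: hK.
Qed.
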